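(* There exists a unique invariant bilinear form $\langle\,,\rangle$ on $\mathcal{M}=\bigoplus_{\beta\in\mathbb{C}^l}M_\beta$ normalized by $\langle\mathbf{1},\mathbf{1}\rangle=1$; it is symmetric and invertible (nondegenerate), and for all $v\otimes e^\beta,\ w\otimes e^\gamma\in\mathcal{M}$ $$\langle v\otimes e^{\beta},w\otimes e^{\gamma}\rangle=\epsilon(\beta,-\beta)\,\lambda^{-\beta^2}\,\delta_{\beta+\gamma,0}\,\langle v,w\rangle .$$
   Context: Fix $l\ge 1$. For $\alpha,\beta\in\mathbb{C}^l$ write $\alpha\cdot\beta=\sum_{i=1}^l\alpha^i\beta^i$ (complex bilinear) and $\alpha^2=\alpha\cdot\alpha$. $M^l$ is the rank $l$ Heisenberg vertex operator algebra, generated by weight one vectors $a^1,\dots,a^l$ whose modes satisfy $[a^i(n),a^j(m)]=n\,\delta_{n,-m}\delta_{i,j}$; it is spanned by the vectors $a^{i_1}(-k_1)\cdots a^{i_r}(-k_r)\mathbf{1}$, $k_j>0$, with Virasoro vector $\omega=\frac12\sum_i a^i(-1)^2\mathbf{1}$ and Virasoro modes $L(n)$. For $\alpha\in\mathbb{C}^l$, $M_\alpha=M^l\otimes e^\alpha$ is the irreducible $M^l$-module with $a^i(0)(u\otimes e^\alpha)=\alpha^i(u\otimes e^\alpha)$ and $a^i(n)(u\otimes e^\alpha)=(a^i(n)u)\otimes e^\alpha$ for $n\ne0$; $M_0=M^l$ and $u\otimes e^0$ is written $u$ (so $\langle v,w\rangle$ for $v,w\in M^l$ is the restriction of the form to $M_0$).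 For $u\in M^l$, $Y(u,z)$ denotes the (module) vertex operator on every $M_\alpha$. Put $\alpha(n)=\sum_i\alpha^ia^i(n)$, $Y_\pm(\alpha,z)=\exp\big(\mp\sum_{n>0}\frac{\alpha(\pm n)}{n}z^{\mp n}\big)$. The operator $e^{\alpha\cdot q}$ on $\mathcal{M}$ is $u\otimes e^\beta\mapsto u\otimes e^{\alpha+\beta}$. Cocycle structure: fix $\epsilon:\mathbb{C}^l\times\mathbb{C}^l\to\mathbb{C}^\times$ with $\epsilon(\alpha,0)=\epsilon(0,\alpha)=1$; let $c_\alpha(u\otimes e^\beta)=\epsilon(\alpha,\beta)u\otimes e^\beta$ and $e^\alpha=e^{\alpha\cdot q}c_\alpha$ as an operator on $\mathcal{M}$; it is assumed that $e^\alpha e^\beta=\epsilon(\alpha,\beta)e^{\alpha+\beta}$, $e^0=1$. Put $C(\alpha,\beta)=\epsilon(\alpha,\beta)/\epsilon(\beta,\alpha)$. The vertex operators on $\mathcal{M}$ are $$\mathcal{Y}(u\otimes e^\alpha,z)=e^\alpha Y_-(\alpha,z)Y(u,z)Y_+(\alpha,z)z^{\alpha(0)},$$ formal series in complex powers of $z$, with $z^{\alpha(0)}$ acting on $M_\gamma$ as $z^{\alpha\cdot\gamma}$, extended linearly in the first argument. Let $N$ be a fixed odd integer and $\lambda\neq0$ a fixed parameter (with complex powers $\lambda^\kappa$ defined by a fixed choice of logarithm of $\lambda$). Powers of $e^{i\pi N}z$ are taken as $(e^{i\pi N}z)^\kappa=e^{i\pi N\kappa}z^\kappa$, written also $(-z)^\kappa$.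 The adjoint of a vertex operator is $$\mathcal{Y}^\dagger(u\otimes e^\alpha,z)=\mathcal{Y}\left(e^{-z\lambda^{-2}L(1)}\left(\frac{\lambda}{e^{i\pi N}z}\right)^{2L(0)}(u\otimes e^\alpha),\ \frac{\lambda^2}{e^{i\pi N}z}\right).$$ A bilinear form $\langle\,,\rangle$ on $\mathcal{M}$ is called invariant if for all $u\otimes e^\alpha,v\otimes e^\beta,w\otimes e^\gamma\in\mathcal{M}$ $$\langle\mathcal{Y}(u\otimes e^\alpha,z)(v\otimes e^\beta),w\otimes e^\gamma\rangle=e^{-i\pi N\alpha\cdot\beta}\,C(\alpha,\beta)\,\langle v\otimes e^\beta,\mathcal{Y}^\dagger(u\otimes e^\alpha,z)(w\otimes e^\gamma)\rangle.$$ *)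

(* Defs.v *)
From HB Require Import structures.
From mathcomp Require Import all_boot all_order all_algebra.
From mathcomp Require Import finmap.
From mathcomp Require Import boolp classical_sets fsbigop reals sequences exp trigo.
From mathcomp Require Import complex.
From mathcomp.multinomials Require Import monalg.

Set Implicit Arguments.
Unset Strict Implicit.
Unset Printing Implicit Defensive.

Import GRing.Theory Num.Theory.

Local Open Scope ring_scope.

Section ComplexExponential.
Variable R : realType.

Definition cexp (z : R[i]) : R[i] :=
  Complex (expR (complex.Re z) * cos (complex.Im z))
          (expR (complex.Re z) * sin (complex.Im z)).

(* [cpow ell k] is x^k for the determination of log x given by [ell]. *)
Definition cpow (ell k : R[i]) : R[i] := cexp (k * ell).

(* e^(i pi N k), i.e. the k-th power of e^(i pi N). *)
Definition epiN (N : int) (k : R[i]) : R[i] :=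
  cpow (Complex 0 (pi *~ N)) k.

End ComplexExponential.

(* The oscillator a^i(-k-1), k >= 0, is indexed by (i, k). *)
Notation osc l := ('I_l * nat)%type.

(* M^l, as the polynomial algebra in the commuting creation operators:
   the monomial m stands for the vector prod_(i,k) a^i(-k-1)^(m (i,k)) 1. *)
Notation Ml C l := {malg C[{cmonom (osc l)}]}.

(* Locked, as are [tens] and [calM_scale] below: deciding that two terms built
   on finite maps are not convertible is otherwise prohibitively slow. *)
HB.lock Definition vmon (C : numFieldType) (l : nat) (m : {cmonom (osc l)}) :
  Ml C l := << m >>.

Arguments vmon.body : clear implicits.

Section Heisenberg.
Variables (C : numFieldType) (l : nat).
Local Notation Cl := 'rV[C]_l.
Local Notation osc := (osc l).
Local Notation Ml := (Ml C l).
Local Notation mon := (vmon C l).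

Definition dot (a b : Cl) : C := \sum_i a 0 i * b 0 i.

Definition osc_var (o : osc) : Ml := mon (ucm o).

(* The action of a^i(n) on M_b: multiplication by the variable for n < 0,
   the scalar b^i for n = 0, and n d/dx_(i,n-1) for n > 0. *)
Definition heis (b : Cl) (i : 'I_l) (n : int) (v : Ml) : Ml :=
  match n with
  | Negz k => osc_var (i, k) * v
  | Posz 0 => b 0 i *: v
  | Posz k.+1 =>
      \sum_(m <- msupp v)
        (v@_m * (k.+1 * m (i, k))%:R) *: mon (divcm m (ucm (i, k)))
  end.

(* Formal fields A(z) = sum_p A_p z^p on M^l: [A v p] is the coefficient of
   z^p in A(z) v. *)
Definition field := Ml -> int -> Ml.

(* Sums over [\in] are finitely supported sums; all those below do have finite
   support. *)
Definition fcomp (A B : field) : field :=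
  fun v p => \sum_(q \in [set: int]) A (B v q) (p - q).

(* Generalized binomial coefficient (-n-1 choose k). *)
Definition dcoef (k : nat) (n : int) : C :=
  match n with
  | Posz j => (-1) ^+ k * 'C(j + k, k)%:R
  | Negz j => 'C(j, k)%:R
  end.

(* (1/k!) d^k/dz^k applied to a^i(z) = sum_n a^i(n) z^(-n-1) on M_b, keeping
   only the modes n satisfying P: the term of z^p is that of n = -p-k-1. *)
Definition dfield (b : Cl) (o : osc) (P : pred int) : field :=
  fun v p =>
    let n : int := - (p + o.2%:Z + 1) in
    if P n then dcoef o.2 n *: heis b o.1 n v else 0.

(* Y(a^(i_1)(-k_1-1) ... a^(i_r)(-k_r-1) 1, z) on M_b, by the normal ordered
   product Y(a^i(-k-1)u, z) = : (1/k!) d^k a^i(z) Y(u, z) :. *)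
Fixpoint Yseq (b : Cl) (s : seq osc) : field :=
  match s with
  | [::] => fun v p => v *+ (p == 0)
  | o :: s' => fun v p =>
      fcomp (dfield b o (fun n => n < 0)) (Yseq b s') v p
      + fcomp (Yseq b s') (dfield b o (fun n => 0 <= n)) v p
  end.

(* The factors of a monomial; their order is immaterial in [Yseq]. *)
Definition factors (m : {cmonom osc}) : seq osc :=
  flatten [seq nseq (m o) o | o <- finsupp m].

Definition Yop (b : Cl) (u : Ml) : field :=
  fun v p => \sum_(m <- msupp u) u@_m *: Yseq b (factors m) v p.

Definition omega : Ml := 2%:R^-1 *: \sum_i osc_var (i, 0%N) ^+ 2.

(* Y(omega, z) = sum_n L(n) z^(-n-2) on M_b. *)
Definition vir (b : Cl) (n : int) (v : Ml) : Ml := Yop b omega v (- n - 2%:Z).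

Definition amode (b a : Cl) (n : int) (v : Ml) : Ml :=
  \sum_i a 0 i *: heis b i n v.

(* Coefficients of t^p in (sum_(n>0) A_n t^n)^r and in its exponential; the
   powers r > p do not contribute to the latter. *)
Fixpoint powcoef (A : nat -> Ml -> Ml) (r p : nat) (v : Ml) : Ml :=
  match r with
  | 0 => v *+ (p == 0%N)
  | r'.+1 => \sum_(1 <= n < p.+1) A n (powcoef A r' (p - n) v)
  end.

Definition expcoef (A : nat -> Ml -> Ml) (p : nat) (v : Ml) : Ml :=
  \sum_(r < p.+1) (r`!%:R)^-1 *: powcoef A r p v.

Definition Yminus (b a : Cl) : field := fun v p =>
  if 0 <= p then
    expcoef (fun n w => n%:R^-1 *: amode b a (- n%:Z) w) `|p|%N v
  else 0.

Definition Yplus (b a : Cl) : field := fun v p =>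
  if p <= 0 then
    expcoef (fun n w => - n%:R^-1 *: amode b a n%:Z w) `|p|%N v
  else 0.

(* Y_-(a, z) Y(u, z) Y_+(a, z) on M_b. *)
Definition Ynorm (a : Cl) (u : Ml) (b : Cl) : field :=
  fcomp (Yminus b a) (fcomp (Yop b u) (Yplus b a)).

(* The eigenvalue of L(0) on the monomial m of M_a, see [vir0_weight]. *)
Definition weight (a : Cl) (m : {cmonom osc}) : C :=
  2%:R^-1 * dot a a + (\sum_(o <- finsupp m) m o * o.2.+1)%N%:R.

Lemma malg_sumU (F : {cmonom osc} -> Ml) m :
  \sum_(m' <- msupp (mon m)) (mon m)@_m' *: F m' = F m.
Proof. by rewrite vmon.unlock msuppU1 big_seq_fset1 mcoeffUU scale1r. Qed.

Lemma malg_sumw (F : {cmonom osc} -> Ml) (d : {fset {cmonom osc}}) (u : Ml) :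
  (msupp u `<=` d)%fset ->
  \sum_(m <- msupp u) u@_m *: F m = \sum_(m <- d) u@_m *: F m.
Proof.
move=> ud; apply: big_fset_incl => // m _ /mcoeff_outdom ->.
by rewrite scale0r.
Qed.

Lemma malg_sumD (F : {cmonom osc} -> Ml) (u w : Ml) :
  \sum_(m <- msupp (u + w)) (u + w)@_m *: F m
  = \sum_(m <- msupp u) u@_m *: F m + \sum_(m <- msupp w) w@_m *: F m.
Proof.
pose d := (msupp u `|` msupp w)%fset.
rewrite (malg_sumw F (msuppD_le u w)).
rewrite (malg_sumw F (fsubsetUl _ (msupp w) : (msupp u `<=` d)%fset)).
rewrite (malg_sumw F (fsubsetUr (msupp u) _ : (msupp w `<=` d)%fset)).
by rewrite -big_split; apply: eq_bigr => m _; rewrite mcoeffD scalerDl.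
Qed.

Lemma malg_sumZ (F : {cmonom osc} -> Ml) c (u : Ml) :
  \sum_(m <- msupp (c *: u)) (c *: u)@_m *: F m
  = c *: \sum_(m <- msupp u) u@_m *: F m.
Proof.
rewrite (malg_sumw F (msuppZ_le c u)) scaler_sumr.
by apply: eq_bigr => m _; rewrite mcoeffZ scalerA.
Qed.

Lemma malg_sum0 (F : {cmonom osc} -> Ml) :
  \sum_(m <- msupp (0 : Ml)) (0 : Ml)@_m *: F m = 0.
Proof. by rewrite msupp0 big_seq_fset0. Qed.

Lemma vmonM m m' : mon m * mon m' = mon (mmul m m').
Proof.
by rewrite vmon.unlock; apply: etrans (fgmulUU _ _ _ _) _; rewrite mulr1.
Qed.

Lemma Yop_omega b v p :
  Yop b omega v p
  = 2%:R^-1 *: \sum_i Yseq b [:: (i, 0%N) : osc; (i, 0%N) : osc] v p.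
Proof.
rewrite /Yop /omega malg_sumZ; congr (_ *: _).
rewrite (big_morph _ (malg_sumD _) (malg_sum0 _)); apply: eq_bigr => i _.
rewrite expr2 vmonM malg_sumU; congr (Yseq _ _ _ _).
rewrite /factors mdomD !mdomU fsetUid.
have -> : ([fset (i, 0%N) : osc]%fset : seq osc) = [:: (i, 0%N)].
  apply: perm_small_eq => //; apply: uniq_perm => [||o] //.
    exact: fset_uniq.
  by rewrite in_fset1 inE.
by rewrite /= cmM cmUU.
Qed.

Lemma fsum_supp (V : nmodType) (T : choiceType) (s : seq T) (F : T -> V) :
  uniq s -> (forall i, i \notin s -> F i = 0) ->
  \sum_(i \in [set: T]) F i = \sum_(i <- s) F i.
Proof.
move=> us Fs; rewrite (fsbigTE [fset i | i in s]%fset); last first.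
  by move=> i; rewrite inE /= => /Fs.
by apply: perm_big; apply: uniq_perm => // i; rewrite inE.
Qed.

Lemma heis0 b i n : heis b i n 0 = 0.
Proof.
case: n => [[|k]|k] /=; first by rewrite scaler0.
  by rewrite msupp0 big_seq_fset0.
by rewrite mulr0.
Qed.

Lemma dfield0 b o P p : dfield b o P 0 p = 0.
Proof. by rewrite /dfield heis0 scaler0; case: ifP. Qed.

Lemma Yseq1 b i v q :
  Yseq b [:: (i, 0%N) : osc] v q = heis b i (- (q + 1)) v.
Proof.
rewrite /= /fcomp (fsum_supp (s := [:: 0])) //; last first.
  by move=> j; rewrite inE => /negbTE ->; rewrite mulr0n dfield0.
rewrite big_seq1 eqxx mulr1n subr0 (fsum_supp (s := [:: q])) //; last first.
  move=> j; rewrite inE subr_eq0 eq_sym => /negbTE ->.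
  by rewrite mulr0n.
rewrite big_seq1 subrr eqxx mulr1n /dfield /= addr0.
have d1 n : dcoef 0 n = 1 :> C.
  by case: n => j; rewrite /dcoef ?bin0 // expr0 mul1r.
by rewrite !d1 !scale1r; case: ltrP; rewrite ?addr0 ?add0r.
Qed.

Lemma heis_posU b i j (m : {cmonom osc}) :
  heis b i j.+1 (mon m)
  = (j.+1 * m (i, j))%:R *: mon (divcm m (ucm (i, j))).
Proof.
rewrite [LHS]/= {1 2}vmon.unlock.
by rewrite msuppU1 big_seq_fset1 mcoeffUU mul1r.
Qed.

Lemma heisU b i j (m : {cmonom osc}) :
  heis b i (Negz j) (heis b i j.+1 (mon m))
  = (j.+1 * m (i, j))%:R *: mon m.
Proof.
rewrite heis_posU.
have [->|mij] := posnP (m (i, j)); first by rewrite muln0 !scale0r heis0.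
rewrite /= -scalerAr vmonM; congr (_ *: mon _); apply/eqP/cmP => o.
rewrite cmM divcmE cmU; case: eqP => [<-|_]; last by rewrite subn0.
by rewrite addnC subnK.
Qed.

Lemma dfield_scal b i P v p :
  dfield b (i, 0%N) P v p = if P (- (p + 1)) then heis b i (- (p + 1)) v else 0.
Proof.
rewrite /dfield /= addr0; have -> : forall n, dcoef 0 n = 1 :> C.
  by case=> j; rewrite /dcoef ?bin0 // expr0 mul1r.
by rewrite scale1r.
Qed.

Lemma vir0_weight b (m : {cmonom osc}) : vir b 0 (mon m) = weight b m *: mon m.
Proof.
have [B Bm] : exists B, forall i j, (B <= j)%N -> m (i, j) = 0%N.
  exists (\max_(o <- finsupp m) o.2.+1) => i j Bj.
  apply/eqP; rewrite cmE_eq0; apply: contraTN Bj => om.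
  by rewrite -ltnNge (big_fsetD1 _ om) /= leq_max ltnSn.
have iotaE : iota 0 B = index_iota 0 B by rewrite /index_iota subn0.
pose E i : C := \sum_(j < B) (j.+1 * m (i, nat_of_ord j))%:R.
have hpos i k : (B <= k)%N -> heis b i k.+1 (mon m) = 0.
  by move=> Bk; rewrite heis_posU Bm // muln0 scale0r.
have term i : Yseq b [:: (i, 0%N); (i, 0%N)] (mon m) (- 0 - 2%:Z)
    = (b 0 i * b 0 i + 2%:R * E i) *: mon m.
  have step q : - 0 - 2%:Z - q = - (q + 1) - 1
    by rewrite oppr0 add0r opprD -[RHS]addrA -[X in _ = _ + X]opprD addrC.
  pose G q := heis b i (q + 1) (heis b i (- (q + 1)) (mon m)).
  have creat q : dfield b (i, 0%N) (fun n => n < 0)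
      (Yseq b [:: (i, 0%N)] (mon m) q) (- 0 - 2%:Z - q)
      = if q + 1 < 0 then G q else 0.
    by rewrite Yseq1 dfield_scal step subrK opprK.
  have annih q : Yseq b [:: (i, 0%N)]
      (dfield b (i, 0%N) (fun n => 0 <= n) (mon m) q) (- 0 - 2%:Z - q)
      = if q + 1 <= 0 then G q else 0.
    rewrite Yseq1 dfield_scal step subrK opprK oppr_ge0.
    by case: ifP => // _; rewrite heis0.
  have NegzD1 j : Negz j.+1 + 1 = Negz j by rewrite !NegzE -addn1 PoszD opprD subrK.
  pose s := [seq Negz j.+1 | j <- iota 0 B].
  have us : uniq s by rewrite map_inj_uniq ?iota_uniq // => j k [].
  have sumE (F : int -> Ml) :
      (forall j, F (Negz j.+1) = heis b i (Negz j) (heis b i j.+1 (mon m))) ->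
      \sum_(q <- s) F q = E i *: mon m.
    move=> Fs; rewrite big_map /E scaler_suml iotaE big_mkord.
    by apply: eq_bigr => j _; rewrite Fs heisU.
  have notin j : Negz j.+1 \notin s -> heis b i j.+1 (mon m) = 0.
    move=> js; apply: hpos; rewrite leqNgt; apply: contra js => jB.
    by apply: map_f; rewrite mem_iota.
  have -> : Yseq b [:: (i, 0%N); (i, 0%N)] (mon m) (- 0 - 2%:Z)
    = fcomp (dfield b (i, 0%N) (fun n => n < 0)) (Yseq b [:: (i, 0%N)]) (mon m)
        (- 0 - 2%:Z)
      + fcomp (Yseq b [:: (i, 0%N)]) (dfield b (i, 0%N) (fun n => 0 <= n)) (mon m)
        (- 0 - 2%:Z) by [].
  rewrite /fcomp (eq_fsbigr (fun q => if q + 1 < 0 then G q else 0)); last first.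
    by move=> q _; exact: creat.
  rewrite [X in _ + X](eq_fsbigr (fun q => if q + 1 <= 0 then G q else 0)); last first.
    by move=> q _; exact: annih.
  rewrite (fsum_supp us); last first.
    case=> [q|[|j]] // js; rewrite /G NegzD1.
    by rewrite -[- Negz j]/(Posz j.+1) notin // heis0.
  rewrite (fsum_supp (s := Negz 0 :: s)); last 2 first.
  - by rewrite /= us andbT; apply/mapP => -[].
  - case=> [q _|[|j]] //; first by rewrite -PoszD addn1.
    rewrite inE /= => js.
    by rewrite /G NegzD1 -[- Negz j]/(Posz j.+1) notin ?heis0.
  rewrite big_cons !sumE => [|j|j]; last 2 first.
  - by rewrite /G NegzD1.
  - by rewrite /G NegzD1.
  have -> : (if Negz 0 + 1 <= 0 then G (Negz 0) else 0)
      = (b 0 i * b 0 i) *: mon m by rewrite -scalerA.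
  by rewrite addrCA mulr_natl mulr2n !scalerDl.
rewrite /vir Yop_omega (eq_bigr _ (fun i _ => term i)) -scaler_suml scalerA.
congr (_ *: mon m).
rewrite /weight /dot big_split /= mulrDr -mulr_sumr mulrA.
rewrite mulVf ?pnatr_eq0 // mul1r; congr (_ + _).
have -> : \sum_i E i
    = \sum_(o <- [seq (i, j) | i <- enum 'I_l, j <- iota 0 B])
        (m o * o.2.+1)%:R.
  rewrite big_allpairs big_enum; apply: eq_bigr => i _.
  rewrite iotaE big_mkord.
  by apply: eq_bigr => j _; rewrite mulnC.
rewrite -natr_sum; congr _%:R.
rewrite (bigID (fun o => o \in finsupp m)) /= [X in (_ + X)%N]big1 ?addn0.
  rewrite -big_filter; apply: perm_big; apply: uniq_perm.
  - rewrite filter_uniq // allpairs_uniq ?enum_uniq ?iota_uniq //.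
    by move=> [? ?] [? ?] _ _ [-> ->].
  - exact: fset_uniq.
  move=> [i j]; rewrite mem_filter andbC; apply: andb_idl => om.
  apply/allpairsP; exists (i, j); rewrite mem_enum mem_iota; split=> //=.
  rewrite add0n ltnNge; apply: contraTN om => /Bm mij.
  by rewrite -cmE_eq0 mij.
by move=> o; rewrite -cmE_eq0 => /eqP ->.
Qed.

End Heisenberg.

(* The direct sum over b in C^l of the M_b: finitely supported families. *)
Definition calM (C : numFieldType) (l : nat) := {malg Ml C l['rV[C]_l]}.

HB.instance Definition _ C l := GRing.Zmodule.on (calM C l).

(* u (x) e^a *)
HB.lock Definition tens (C : numFieldType) (l : nat) (u : Ml C l)
  (a : 'rV[C]_l) : calM C l := << u *g a >>.

(* The multiples over C; {malg _} only has those over Ml, which is a C-algebra. *)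
HB.lock Definition calM_scale (C : numFieldType) (l : nat) (c : C)
    (x : calM C l) : calM C l :=
  (c%:A : Ml C l) *: (x : {malg Ml C l['rV[C]_l]}).

Section TotalSpace.
Variables (C : numFieldType) (l : nat).
Local Notation Cl := 'rV[C]_l.
Local Notation Ml := (Ml C l).
Local Notation mon := (vmon C l).
Local Notation calM := (calM C l).

Definition comp (b : Cl) (x : calM) : Ml := mcoeff b x.
Definition supp (x : calM) : seq Cl := msupp x.

Lemma comp_scale c x b : comp b (calM_scale c x) = c *: comp b x.
Proof. by rewrite calM_scale.unlock /comp mcoeffZ mulr_algl. Qed.

Lemma compD b x y : comp b (x + y) = comp b x + comp b y.
Proof. exact: mcoeffD. Qed.

Lemma calM_ext (x y : calM) : (forall b, comp b x = comp b y) -> x = y.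
Proof. by move=> xy; apply/malgP => b; exact: xy. Qed.

Fact calM_scaleA (c d : C) (x : calM) :
  calM_scale c (calM_scale d x) = calM_scale (c * d) x.
Proof. by apply: calM_ext => b; rewrite !comp_scale scalerA. Qed.

Fact calM_scale1 : left_id 1 (@calM_scale.body C l).
Proof. by move=> x; apply: calM_ext => b; rewrite comp_scale scale1r. Qed.

Fact calM_scaleDr : right_distributive (@calM_scale.body C l) +%R.
Proof.
by move=> c x y; apply: calM_ext => b; rewrite compD !comp_scale compD scalerDr.
Qed.

Fact calM_scaleDl (x : calM) : {morph (@calM_scale.body C l)^~ x : c d / c + d}.
Proof.
by move=> c d; apply: calM_ext => b; rewrite compD !comp_scale scalerDl.
Qed.

HB.instance Definition _ := GRing.Zmodule_isLmodule.Build C calM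
  calM_scaleA calM_scale1 calM_scaleDr calM_scaleDl.

Definition Lop (n : int) (x : calM) : calM :=
  \sum_(b <- supp x) tens (vir b n (comp b x)) b.

(* Projection onto the h-eigenspace of L(0), by [vir0_weight]. *)
Definition L0proj (h : C) (x : calM) : calM :=
  \sum_(b <- supp x) \sum_(m <- msupp (comp b x) | weight b m == h)
    tens ((comp b x)@_m *: mon m) b.

Section Cocycle.
Variable eps : Cl -> Cl -> C.

Definition eshift (a : Cl) (x : calM) : calM :=
  \sum_(b <- supp x) tens (comp b x) (a + b).

Definition cop (a : Cl) (x : calM) : calM :=
  \sum_(b <- supp x) tens (eps a b *: comp b x) b.

(* e^a as an operator on calM *)
Definition eop (a : Cl) (x : calM) : calM := eshift a (cop a x).

Definition cocycle_structure : Prop :=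
  [/\ forall a b, eps a b != 0,
      forall a, eps a 0 = 1 /\ eps 0 a = 1,
      forall a b x, eop a (eop b x) = eps a b *: eop (a + b) x
    & forall x, eop 0 x = x].

Definition commutator (a b : Cl) : C := eps a b / eps b a.

(* Coefficient of z^k, k complex, in calY(u (x) e^a, z) (v (x) e^b); the factor
   z^(a.b) is the action of z^(a(0)). *)
Definition calYtens (u : Ml) (a : Cl) (v : Ml) (b : Cl) (k : C) : calM :=
  eop a (\sum_(p \in [set p : int | p%:~R + dot a b = k])
           tens (Ynorm a u b v p) b).

Definition calY (x y : calM) (k : C) : calM :=
  \sum_(a <- supp x) \sum_(b <- supp y) calYtens (comp a x) a (comp b y) b k.

(* [lpow k] stands for lam^k and [epow k] for e^(i pi N k). *)
Variables (lam : C) (lpow epow : C -> C).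

(* Coefficient of z^k in (lam / (e^(i pi N) z))^(2 L(0)) x: on the h-eigenspace
   of L(0) this is lam^(2h) e^(-i pi N 2h) z^(-2h). *)
Definition scaleL0 (x : calM) (k : C) : calM :=
  (lpow (- k) * epow k) *: L0proj (- k / 2%:R) x.

(* Coefficient of z^k in e^(- z lam^(-2) L(1)) applied to the series above. *)
Definition adj_arg (x : calM) (k : C) : calM :=
  \sum_(r \in [set: nat])
    ((- lam ^- 2) ^+ r / r`!%:R) *: iter r (Lop 1) (scaleL0 x (k - r%:R)).

(* Coefficient of z^k in calY^dagger(x, z) y: the term of z^j in the first
   argument meets the term of exponent j - k of calY, in which the variable is
   (lam^2 / (e^(i pi N) z)). *)
Definition calYdag (x y : calM) (k : C) : calM :=
  \sum_(j \in [set: C])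
    (lpow (2%:R * (j - k)) * epow (- (j - k))) *:
      calY (adj_arg x j) y (j - k).

Definition invariant_form (B : calM -> calM -> C) : Prop :=
  forall (u : Ml) (a : Cl) (v : Ml) (b : Cl) (w : Ml) (c : Cl) (k : C),
    B (calY (tens u a) (tens v b) k) (tens w c)
    = epow (- dot a b) * commutator a b
      * B (tens v b) (calYdag (tens u a) (tens w c) k).

End Cocycle.

Definition vacuum : calM := tens 1 0.

Definition nondegenerate_form (B : calM -> calM -> C) : Prop :=
  (forall x, (forall y, B x y = 0) -> x = 0) /\
  (forall y, (forall x, B x y = 0) -> y = 0).

End TotalSpace.

(* Main.v *)
Require Import Defs.
From HB Require Import structures.
From mathcomp Require Import all_boot all_order all_algebra.
From mathcomp Require Import finmap.
From mathcomp Require Import boolp classical_sets fsbigop reals sequences exp trigo.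
From mathcomp Require Import complex.
From mathcomp.multinomials Require Import monalg.
From mathcomp Require Import zify ring.
Import Order.TTheory GRing.Theory Num.Theory.
Local Open Scope ring_scope.

(** M^l is the polynomial algebra in the creation operators a^i(-k), so a form on
    the sum of the M_b amounts to a family of forms on this algebra. Put
    th = - lam^2, and let [hform] be the form on M^l for which monomials are
    orthogonal and a^i(n), n <> 0, has the adjoint - th^n a^i(-n). The invariant
    form is [Bform]: it pairs M_b with M_(-b) only, by
    eps(b, -b) lam^(-b^2) [hform].

    Uniqueness. The vector a^i(-1) 1 of M_0 is killed by L(1), so its adjoint
    vertex operator is elementary, and invariance says that a^i(n) has the
    adjoint - th^n a^i(-n) for every invariant form and every n, zero included
    ([inv_heis]). The case n = 0 makes M_b and M_c orthogonal unless b + c = 0.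
    The other modes move all oscillators from one argument to the other, where
    they end up annihilating 1, so only the values on the pairs e^b, e^(-b) remain
    to be found. Invariance for e^b on the vacuum gives them ([inv_charge]).

    Existence. The factors eps cancel by the cocycle identity and the complex
    powers of lam, z and e^(i pi N) by comparing exponents ([adjcoefE]). What is
    left of invariance is a statement on M^l, [Ynorm_adjoint]: for a + b + c = 0
    the adjoint of Y_-(a, z) Y(m, z) Y_+(a, z) on M_b is, up to a scalar for each
    power of z, the same expression on M_c with exp(L(1)) m in place of m, where
    L(1) acts on M_a. This is proved by induction on the number of oscillators of
    the monomial m. For m = 1 the adjoint exchanges Y_- and Y_+. Each further
    oscillator contributes a normally ordered product, hence a sum over the modes
    a^i(n) ([Ynorm_osc_var]), and taking adjoints replaces n by - n. On the other
    side [L(1), a^i(-q)] = q a^i(1-q) makes exp(L(1)) a^i(-k-1) a binomial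
    combination of the a^i(j-k-1) exp(L(1)), 0 <= j <= k + 1 ([divpow_raise]),
    whose fields are again sums over modes. The coefficients of the two sums agree
    by a Vandermonde identity ([dcoef_translation]). In the mode n = 0 the
    summand j = k + 1, which is the scalar a^i, makes up for the difference
    between the actions of a^i(0) on M_b and on M_c.

    Infinite sums. All operators shift the weight by a fixed amount ([degle],
    [is_graded]), so on a given vector only finitely many modes act; sums over
    modes are cut off at |n| <= K, for any K that is large enough. *)

Set Implicit Arguments.
Unset Strict Implicit.
Unset Printing Implicit Defensive.

(** * Linear functions and the weight filtration of M^l *)

Section LinearFunctions.
Variables (R : nzRingType) (U V : lmodType R).

Lemma lin_add (f : U -> V) : linear f -> {morph f : x y / x + y}.
Proof. by move=> lf x y; rewrite -[x]scale1r lf !scale1r. Qed.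

Lemma lin0 (f : U -> V) : linear f -> f 0 = 0.
Proof. by move=> lf; apply: (addrI (f 0)); rewrite -lin_add // !addr0. Qed.

Lemma lin_scale (f : U -> V) : linear f -> forall c x, f (c *: x) = c *: f x.
Proof. by move=> lf c x; rewrite -[c *: x]addr0 lf lin0 // addr0. Qed.

Lemma lin_sum (f : U -> V) : linear f ->
  forall (I : Type) (r : seq I) (P : pred I) (F : I -> U),
  f (\sum_(i <- r | P i) F i) = \sum_(i <- r | P i) f (F i).
Proof. by move=> lf I r P F; apply: big_morph; [exact: lin_add | exact: lin0]. Qed.

Lemma linear_big (I : Type) (r : seq I) (F : I -> U -> V) :
  (forall i, linear (F i)) -> linear (fun x => \sum_(i <- r) F i x).
Proof.
move=> lF c x y; rewrite scaler_sumr -big_split.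
by apply: eq_bigr => i _; rewrite lF.
Qed.

(** Vertex operators are given by infinite sums that become finite, with a
    cut-off that depends on the vector: each cut-off sum is linear, and any
    three vectors have a common cut-off. *)
Lemma linear_eventually (f : U -> V) (g : nat -> U -> V) :
  (forall K, linear (g K)) ->
  (forall x, exists K0, forall K, (K0 <= K)%N -> f x = g K x) -> linear f.
Proof.
move=> lg fg c x y; have [K1 E1] := fg x; have [K2 E2] := fg y.
have [K3 E3] := fg (c *: x + y).
rewrite (E1 (K1 + K2 + K3)%N) ?(E2 (K1 + K2 + K3)%N) ?(E3 (K1 + K2 + K3)%N).
- exact: lg.
- exact: leq_addl.
- by rewrite -addnA addnCA leq_addr.
- by rewrite -addnA leq_addr.
Qed.

End LinearFunctions.

Lemma linear_scaled (R : comNzRingType) (U V : lmodType R) (c : R) (f : U -> V) :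
  linear f -> linear (fun x => c *: f x).
Proof. by move=> lf d x y; rewrite lf scalerDr !scalerA mulrC. Qed.

Lemma linear_compose (R : nzRingType) (U V W : lmodType R) (f : V -> W)
  (g : U -> V) : linear f -> linear g -> linear (fun x => f (g x)).
Proof. by move=> lf lg c x y; rewrite lg lf. Qed.

Section Degree.
Variables (C : numFieldType) (l : nat).
Local Notation osc := (osc l).
Local Notation Ml := (Ml C l).
Local Notation mon := (vmon C l).
Local Notation monom := {cmonom osc}.

Lemma mcoeff_vmon m m' : (mon m)@_m' = (m == m')%:R.
Proof. by rewrite vmon.unlock mcoeffU1. Qed.

Lemma vmon_sum (v : Ml) : v = \sum_(m <- msupp v) v@_m *: mon m.
Proof.
apply/malgP => k; rewrite raddf_sum /=.
transitivity (\sum_(m <- msupp v) v@_m *+ (m == k)).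
  have [kv|kv] := boolP (k \in msupp v).
    by rewrite (bigD1_seq k) ?fset_uniq //= eqxx big1 ?addr0 // => i /negbTE ->.
  rewrite mcoeff_outdom // big1_seq // => i /= iv.
  by case: eqP => // ik; rewrite -ik iv in kv.
by apply: eq_bigr => m _; rewrite mcoeffZ mcoeff_vmon mulr_natr.
Qed.

Lemma lin_mon_ext (V : lmodType C) (f g : Ml -> V) :
  linear f -> linear g -> (forall m, f (mon m) = g (mon m)) -> f =1 g.
Proof.
move=> lf lg fg v; rewrite (vmon_sum v) !lin_sum //.
by apply: eq_bigr => m _; rewrite !lin_scale // fg.
Qed.

Definition mwt (m : monom) : nat := \sum_(o <- finsupp m) m o * o.2.+1.

Lemma mwt_widen (d : {fset osc}) (m : monom) : (finsupp m `<=` d)%fset ->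
  mwt m = (\sum_(o <- d) m o * o.2.+1)%N.
Proof.
move=> md; apply: big_fset_incl => // o _.
by rewrite -cmE_eq0 => /eqP ->.
Qed.

Lemma mwtM (m m' : monom) : mwt (mmul m m') = (mwt m + mwt m')%N.
Proof.
pose d := (finsupp m `|` finsupp m')%fset.
rewrite (mwt_widen (d := d) (m := m)) ?fsubsetUl //.
rewrite (mwt_widen (d := d) (m := m')) ?fsubsetUr //.
rewrite (mwt_widen (d := d) (m := mmul m m')) ?mdomD //.
by rewrite -big_split; apply: eq_bigr => o _; rewrite cmM mulnDl.
Qed.

Lemma mwtU o : mwt (ucm o) = o.2.+1.
Proof. by rewrite /mwt mdomU big_seq_fset1 cmUU mul1n. Qed.

Lemma mwt1 : mwt mone = 0%N.
Proof. by rewrite /mwt mdom1 big_seq_fset0. Qed.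

(** The bound is an integer because operators shift it by integers; a negative
    bound then forces the vector to vanish. *)
Definition degle (D : int) (v : Ml) : bool :=
  all (fun m => (mwt m)%:Z <= D) (msupp v).

Lemma degleP (D : int) v :
  reflect (forall m, D < (mwt m)%:Z -> v@_m = 0) (degle D v).
Proof.
apply: (iffP allP) => [Dv m Dm | Dv m].
  apply: mcoeff_outdom; apply/negP => /Dv.
  by rewrite leNgt Dm.
by rewrite -mcoeff_neq0 leNgt; apply: contra => /Dv ->.
Qed.

Lemma degle0 (D : int) : degle D 0.
Proof. by apply/degleP => m _; rewrite mcoeff0. Qed.

Lemma degleD (D : int) v w : degle D v -> degle D w -> degle D (v + w).
Proof.
move=> /degleP Dv /degleP Dw; apply/degleP => m Dm.
by rewrite mcoeffD Dv // Dw // addr0.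
Qed.

Lemma degleZ (D : int) c v : degle D v -> degle D (c *: v).
Proof.
by move=> /degleP Dv; apply/degleP => m Dm; rewrite mcoeffZ Dv // mulr0.
Qed.

Lemma degle_sum (D : int) (I : Type) (r : seq I) (P : pred I) (F : I -> Ml) :
  (forall i, P i -> degle D (F i)) -> degle D (\sum_(i <- r | P i) F i).
Proof.
move=> DF; apply: (big_ind (fun v => degle D v)) => //; first exact: degle0.
by move=> v w; apply: degleD.
Qed.

Lemma degle_le (D D' : int) v : degle D v -> D <= D' -> degle D' v.
Proof. by move=> /allP Dv DD'; apply/allP => m /Dv /le_trans; apply. Qed.

Lemma degle_lt0 (D : int) v : D < 0 -> degle D v -> v = 0.
Proof.
move=> D0 /degleP Dv; apply/malgP => m; rewrite mcoeff0; apply: Dv.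
exact: lt_le_trans D0 _.
Qed.

Lemma degle_mon (D : int) m : (mwt m)%:Z <= D -> degle D (mon m).
Proof.
move=> mD; apply/degleP => m'; rewrite mcoeff_vmon; case: eqP => // <-.
by rewrite ltNge mD.
Qed.

Lemma degle_lin (D D' : int) (T : Ml -> Ml) : linear T ->
  (forall m, (mwt m)%:Z <= D -> degle D' (T (mon m))) ->
  forall v, degle D v -> degle D' (T v).
Proof.
move=> lT DT v /degleP Dv; rewrite (vmon_sum v) lin_sum //.
apply: degle_sum => m _.
rewrite lin_scale //; have [mD|Dm] := lerP (mwt m)%:Z D.
  by apply: degleZ; apply: DT.
by rewrite Dv // scale0r; exact: degle0.
Qed.

Lemma degle_linear_eq (D : int) (V : lmodType C) (f g : Ml -> V) :
  linear f -> linear g ->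
  (forall m, (mwt m)%:Z <= D -> f (mon m) = g (mon m)) ->
  forall v, degle D v -> f v = g v.
Proof.
move=> lf lg fg v /allP Dv; rewrite (vmon_sum v) !lin_sum //.
apply: eq_big_seq => m mv; rewrite !lin_scale // fg //.
exact: Dv.
Qed.

Lemma degle_exists v : exists d : nat, degle d%:Z v.
Proof.
exists (\max_(m <- msupp v) mwt m)%N; apply/allP => m mv.
by rewrite lez_nat (big_fsetD1 m) //= leq_maxl.
Qed.

End Degree.

(** * The Heisenberg relations *)

Section HeisenbergRelations.
Variables (C : numFieldType) (l : nat).
Local Notation osc := (osc l).
Local Notation Ml := (Ml C l).
Local Notation mon := (vmon C l).
Local Notation monom := {cmonom osc}.
Local Notation Cl := 'rV[C]_l.
Implicit Types (b : Cl) (i : 'I_l) (m : monom) (v : Ml).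

Lemma scale_eq (c d : C) v w : c = d -> v = w -> c *: v = d *: w.
Proof. by move=> -> ->. Qed.

Lemma heis_linear b i n : linear (heis b i n).
Proof.
case: n => [[|k]|k] c x y /=; first by rewrite scalerDr !scalerA mulrC.
  under eq_bigr do rewrite -scalerA.
  under [in X in _ = X + _]eq_bigr do rewrite -scalerA.
  under [in X in _ = _ + X]eq_bigr do rewrite -scalerA.
  by rewrite malg_sumD malg_sumZ.
by rewrite mulrDr scalerAr.
Qed.

Lemma osc_var_mon (o : osc) m : osc_var C o * mon m = mon (mmul (ucm o) m).
Proof. exact: vmonM. Qed.

Lemma heis_neg_mon b i k m :
  heis b i (Negz k) (mon m) = mon (mmul (ucm (i, k)) m).
Proof. exact: vmonM. Qed.

Lemma heis_degle b i n (D : int) v :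
  degle D v -> degle (D - n) (heis b i n v).
Proof.
apply: degle_lin; first exact: heis_linear.
case: n => [[|k]|k] m mD; last 1 first.
- rewrite heis_neg_mon; apply: degle_mon.
  by rewrite mwtM mwtU PoszD NegzE opprK addrC lerD2r.
- by rewrite subr0; apply: degleZ; apply: degle_mon.
rewrite heis_posU; have [->|mk] := posnP (m (i, k)).
  by rewrite muln0 scale0r; exact: degle0.
apply: degleZ; apply: degle_mon.
have mE : m = mmul (ucm (i, k)) (divcm m (ucm (i, k))).
  apply/eqP/cmP => o; rewrite cmM divcmE cmU; case: eqP => [<-|_].
    by rewrite subnKC.
  by rewrite subn0.
by rewrite lerBrDl -PoszD -(mwtU (i, k)) -mwtM -mE.
Qed.

Lemma heis_indep b b' i n v : n != 0 -> heis b i n v = heis b' i n v.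
Proof.
by case: n => [[|k] n0|k _]; [case/eqP: n0 | exact: erefl | exact: erefl].
Qed.

Lemma heis_zero b i v : heis b i 0 v = b 0 i *: v.
Proof. by []. Qed.

Lemma divcmCA (o o' : osc) m :
  divcm (divcm m (ucm o)) (ucm o') = divcm (divcm m (ucm o')) (ucm o).
Proof. by apply/eqP/cmP => q; rewrite !divcmE; exact: subnAC. Qed.

Lemma heis_pos_comm b b' i j n k v :
  heis b i n.+1 (heis b' j k.+1 v) = heis b' j k.+1 (heis b i n.+1 v).
Proof.
move: v; apply: lin_mon_ext => [||m].
- by apply: linear_compose; exact: heis_linear.
- by apply: linear_compose; exact: heis_linear.
rewrite !heis_posU !(lin_scale (heis_linear _ _ _)) !heis_posU !scalerA.
rewrite divcmCA; apply: scale_eq; last exact: erefl.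
rewrite !divcmE !cmU.
have [E|ne] := eqVneq (i, n) (j, k).
  by case: E => -> ->.
by rewrite !subn0 mulrC.
Qed.

Lemma heis_pos_neg b b' i j n k v :
  heis b i n.+1 (heis b' j (Negz k) v)
  = heis b' j (Negz k) (heis b i n.+1 v)
    + (n.+1 * ((i, n) == (j, k)))%:R *: v.
Proof.
move: v; apply: lin_mon_ext => [||m].
- by apply: linear_compose; exact: heis_linear.
- move=> c x y; rewrite !heis_linear !scalerDr !scalerA addrACA.
  by rewrite [c * _]mulrC.
rewrite heis_neg_mon !heis_posU (lin_scale (heis_linear _ _ _)) heis_neg_mon.
rewrite cmM cmU [(j, k) == _]eq_sym mulnDr addnC natrD.
have [E|ne] := eqVneq (i, n) (j, k).
  case: E => -> ->; rewrite scalerDl; apply: congr2; last first.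
    apply: scale_eq; first exact: erefl.
    apply: congr1; apply/eqP/cmP => o.
    by rewrite divcmE cmM addnC addnK.
  have [->|mk] := posnP (m (j, k)); first by rewrite muln0 !scale0r.
  apply: scale_eq; first exact: erefl.
    apply: congr1; apply/eqP/cmP => o.
  rewrite !(divcmE, cmM) cmU; case: eqP => [<-|_].
    by rewrite subnKC // addnC addnK.
  by rewrite !subn0.
rewrite muln0 addr0 scale0r addr0.
have [->|mk] := posnP (m (i, n)); first by rewrite muln0 !scale0r.
apply: scale_eq; first exact: erefl.
    apply: congr1; apply/eqP/cmP => o.
rewrite !(divcmE, cmM) !cmU; case: eqP => [<-|_].
  by rewrite (negbTE ne) !subn0.
by rewrite !add0n.
Qed.

Lemma heis_comm b b' i j n k v :
  heis b i n (heis b' j k v)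
  = heis b' j k (heis b i n v)
    + (n *+ ((i == j) && (n + k == 0)))%:~R *: v.
Proof.
case: n => [[|n]|n].
- rewrite !heis_zero (lin_scale (heis_linear _ _ _)) mul0rn scale0r addr0 //.
- case: k => [[|k]|k].
  + by rewrite !heis_zero (lin_scale (heis_linear _ _ _)) andbF scale0r addr0.
  + by rewrite heis_pos_comm andbF scale0r addr0.
  + rewrite heis_pos_neg xpair_eqE NegzE subr_eq0.
    rewrite eqz_nat eqSS; apply: congr2; first exact: erefl.
    apply: scale_eq; last exact: erefl.
    by case: (_ && _); rewrite ?muln1 ?mulr1n ?muln0 ?mulr0n.
- case: k => [[|k]|k].
  + by rewrite !heis_zero (lin_scale (heis_linear _ _ _)) andbF scale0r addr0.
  + rewrite heis_pos_neg xpair_eqE -addrA -scalerDl.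
    have -> : (k.+1 * ((j == i) && (k == n)))%:R
        + (Negz n *+ ((i == j) && (Negz n + k.+1 == 0)))%:~R = 0 :> C.
      rewrite NegzE addrC [- _ + _]addrC subr_eq0 eqz_nat eqSS [j == i]eq_sym.
      have [->|_] := eqVneq k n; last by rewrite !andbF muln0 mulr0n addr0.
      case: (i == j); last by rewrite muln0 mulr0n addr0.
      by rewrite muln1 mulr1n mulrNz addNr.
    by rewrite scale0r addr0.
  + by rewrite andbF scale0r addr0 /= mulrCA.
Qed.

End HeisenbergRelations.

(** * Normally ordered products as sums over modes *)

Section Modes.

Definition modes (K : nat) : seq int := [seq j%:Z - K%:Z | j <- iota 0 K.*2.+1].

Lemma mem_modes K (n : int) : (n \in modes K) = (`|n| <= K%:Z).
Proof.
apply/mapP/idP => [[j + ->]|nK]; first by rewrite mem_iota; lia.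
by exists (absz (n + K%:Z)); rewrite ?mem_iota; lia.
Qed.

Lemma modes_uniq K : uniq (modes K).
Proof. by rewrite map_inj_uniq ?iota_uniq // => i j; lia. Qed.

Lemma sum_modes_opp (V : nmodType) K (F : int -> V) :
  \sum_(n <- modes K) F n = \sum_(n <- modes K) F (- n).
Proof.
rewrite -(big_map -%R xpredT F); apply: perm_big; apply: uniq_perm.
- exact: modes_uniq.
- by rewrite (map_inj_uniq (@oppr_inj _)) modes_uniq.
move=> n; rewrite mem_modes; apply/idP/mapP => [nK|[m]].
  by exists (- n); rewrite ?opprK // mem_modes normrN.
by rewrite mem_modes => mK ->; rewrite normrN.
Qed.

Lemma sum_modes1 (V : nmodType) K (F : int -> V) n0 :
  `|n0| <= K%:Z -> (forall n, n != n0 -> F n = 0) ->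
  \sum_(n <- modes K) F n = F n0.
Proof.
move=> nK F0; rewrite (bigD1_seq n0) ?modes_uniq ?mem_modes //=.
by rewrite big1 ?addr0.
Qed.

Lemma fsum_inj (V : nmodType) (T : eqType) (f : T -> int) (s : seq T)
    (F : int -> V) :
  injective f -> uniq s -> (forall q, q \notin map f s -> F q = 0) ->
  \sum_(q \in [set: int]) F q = \sum_(n <- s) F (f n).
Proof.
move=> injf us F0; rewrite (fsum_supp (s := map f s)) ?big_map //.
by rewrite map_inj_uniq.
Qed.

Lemma exchange_sum (V : nmodType) (I J : Type) (r : seq I) (s : seq J)
    (F : I -> J -> V) :
  \sum_(i <- r) \sum_(j <- s) F i j = \sum_(j <- s) \sum_(i <- r) F i j.
Proof. exact: exchange_big. Qed.

Lemma sum_split (V : nmodType) (I : Type) (r : seq I) (F G : I -> V) :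
  \sum_(i <- r) (F i + G i) = \sum_(i <- r) F i + \sum_(i <- r) G i.
Proof. exact: big_split. Qed.

End Modes.

Section VertexOperators.
Variables (C : numFieldType) (l : nat).
Local Notation osc := (osc l).
Local Notation Ml := (Ml C l).
Local Notation mon := (vmon C l).
Local Notation monom := {cmonom osc}.
Local Notation Cl := 'rV[C]_l.
Implicit Types (b : Cl) (i : 'I_l) (m : monom) (v : Ml) (s : seq osc) (o : osc).

Lemma heis_high b i (n D : int) v : degle D v -> D < n -> heis b i n v = 0.
Proof.
by move=> Dv Dn; apply: (degle_lt0 _ (heis_degle b i n Dv)); rewrite subr_lt0.
Qed.

(** In a normally ordered product : a^i(z) A(z) : the mode a^i(n) acts after
    A(z) if n < 0 ([lmode]) and before it if n >= 0 ([rmode]). *)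
Definition lmode i (n : int) v : Ml := if n < 0 then heis 0 i n v else v.
Definition rmode b i (n : int) v : Ml := if n < 0 then v else heis b i n v.

Lemma lmode_linear i n : linear (lmode i n).
Proof.
rewrite /lmode => c x y; case: (n < 0); first by rewrite heis_linear.
exact: erefl.
Qed.

Lemma rmode_linear b i n : linear (rmode b i n).
Proof.
rewrite /rmode => c x y; case: (n < 0); last by rewrite heis_linear.
exact: erefl.
Qed.

Lemma lmode_comm i j n k v : lmode i n (lmode j k v) = lmode j k (lmode i n v).
Proof.
rewrite /lmode; case: ltrP => [n0|_]; case: ltrP => [k0|_]; try exact: erefl.
rewrite heis_comm; have -> : (n + k == 0) = false by lia.
by rewrite andbF mulr0n scale0r addr0.
Qed.

Lemma rmode_comm b b' i j n k v :
  rmode b i n (rmode b' j k v) = rmode b' j k (rmode b i n v).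
Proof.
rewrite /rmode; case: ltrP => [_|n0]; case: ltrP => [_|k0]; try exact: erefl.
rewrite heis_comm; have [->|nN0] := eqVneq n 0.
  by rewrite mul0rn scale0r addr0.
have -> : (n + k == 0) = false by lia.
by rewrite andbF mulr0n scale0r addr0.
Qed.

Lemma rmode_degle b i (n D : int) v : degle D v ->
  exists D' : int, [/\ degle D' (rmode b i n v), D' <= D & D' + n <= D].
Proof.
rewrite /rmode; case: ltrP => n0 Dv; first by exists D; split; [|lia|lia].
by exists (D - n); split; [exact: heis_degle|lia|lia].
Qed.

Definition swt s : nat := \sum_(o <- s) o.2.+1.

(** The field of a vector of weight h: its coefficient of z^p raises weights
    by p + h. *)
Definition is_graded (h : int) (A : field C l) : Prop :=
  forall (D p : int) v, degle D v -> degle (D + p + h) (A v p).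

(** The coefficients of : (1/k!) d^k a^i(z) A(z) : for o = (i, k), where the sum
    over the modes of a^i(z) is cut off at |n| <= K. *)
Definition mode_sum b o (K : nat) (A : field C l) v (p : int) : Ml :=
  \sum_(n <- modes K)
    dcoef C o.2 n *: lmode o.1 n (A (rmode b o.1 n v) (p + n + o.2.+1%:Z)).

Lemma mode_sum_linear b o K (A : field C l) p :
  (forall q, linear (A ^~ q)) -> linear (fun v => mode_sum b o K A v p).
Proof.
move=> lA; apply: linear_big => n; apply: linear_scaled.
move=> c x y; rewrite rmode_linear.
have -> q x' y' : A (c *: x' + y') q = c *: A x' q + A y' q by exact: (lA q).
by rewrite lmode_linear.
Qed.

Lemma mode_sum_graded b o K (A : field C l) (h : int) :
  is_graded h A -> is_graded (h + o.2.+1%:Z) (mode_sum b o K A).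
Proof.
move=> gA D p v Dv; apply: degle_sum => n _; apply: degleZ.
rewrite /lmode /rmode; case: (ltrP n 0) => n0.
  by apply: (degle_le (heis_degle _ _ _ (gA _ (p + n + o.2.+1%:Z) _ Dv))); lia.
by apply: (degle_le (gA _ (p + n + o.2.+1%:Z) _ (heis_degle _ _ n Dv))); lia.
Qed.

(** Modes beyond the cut-off do not contribute: a^i(n) with n > D kills a vector
    of weight at most D, and for n < - K the coefficient of A(z) that precedes
    a^i(n) would produce a vector of negative weight. *)
Lemma normal_order_mode_sum b o (A : field C l) (h D p : int) (K : nat) v :
  (forall q, linear (A ^~ q)) -> is_graded h A -> degle D v ->
  D < K%:Z -> D + p + h + o.2.+1%:Z < K%:Z ->
  fcomp (dfield b o (fun n => n < 0)) A v p
    + fcomp A (dfield b o (fun n => 0 <= n)) v p = mode_sum b o K A v p.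
Proof.
move=> lA gA Dv DK DpK; rewrite /fcomp.
have dE P w q : dfield b o P w q = if P (- (q + o.2.+1%:Z))
    then dcoef C o.2 (- (q + o.2.+1%:Z)) *: heis b o.1 (- (q + o.2.+1%:Z)) w
    else 0.
  by rewrite /dfield -addrA -PoszD addn1.
have A0 q : A 0 q = 0 by exact: (lin0 (lA q)).
rewrite (fsum_inj (f := fun n => p + n + o.2.+1%:Z) (s := modes K)); last 3 first.
- by move=> x y; lia.
- exact: modes_uniq.
- move=> q qK; rewrite dE; case: ifP => n0; last exact: erefl.
  suff /degle_lt0/(_ (gA _ q _ Dv)) -> : D + q + h < 0 by rewrite heis0 scaler0.
  move: qK; rewrite ltNge; apply: contra => qD; apply/mapP.
  exists (q - p - o.2.+1%:Z); last by lia.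
  by rewrite mem_modes; lia.
rewrite (fsum_inj (f := fun n => - n - o.2.+1%:Z) (s := modes K)); last 3 first.
- by move=> x y; lia.
- exact: modes_uniq.
- move=> q qK; rewrite dE; case: ifP => n0; last exact: A0.
  suff /(heis_high b o.1 Dv) -> : D < - (q + o.2.+1%:Z) by rewrite scaler0 A0.
  move: qK; rewrite ltNge; apply: contra => qD; apply/mapP.
  exists (- q - o.2.+1%:Z); last by lia.
  by rewrite mem_modes; lia.
rewrite -big_split /=; apply: eq_bigr => n _.
rewrite !dE /lmode /rmode.
have -> : - (p - (p + n + o.2.+1%:Z) + o.2.+1%:Z) = n by lia.
have -> : - (- n - o.2.+1%:Z + o.2.+1%:Z) = n by lia.
have -> : p - (- n - o.2.+1%:Z) = p + n + o.2.+1%:Z by lia.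
have [n0|n0] := ltrP n 0.
  rewrite A0 addr0; apply: scale_eq; first exact: erefl.
  by apply: heis_indep; lia.
by rewrite (lin_scale (lA _)) add0r.
Qed.

(** Linearity and the grading are proved together: the finite expression of
    the field of o :: s requires both for the field of s. *)
Lemma Yseq_linear_graded b s :
  (forall p, linear (Yseq b s ^~ p)) /\ is_graded (swt s)%:Z (Yseq b s).
Proof.
elim: s => [|o s [lY gY]].
  split=> [p c x y /=|D p v Dv /=]; first by rewrite mulrnDl scalerMnr.
  rewrite /swt big_nil; have [->|_] := eqVneq p 0.
    by rewrite mulr1n !addr0.
  by rewrite mulr0n; exact: degle0.
have YE D v (p : int) : degle D v -> exists K0 : nat, forall K, (K0 <= K)%N ->
    Yseq b (o :: s) v p = mode_sum b o K (Yseq b s) v p.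
  move=> Dv; exists (`|D| + `|p| + swt s + o.2.+1).+1%N => K KK.
  by apply: (normal_order_mode_sum _ lY gY Dv); lia.
split=> [p|D p v Dv].
  apply: (linear_eventually (g := fun K v => mode_sum b o K (Yseq b s) v p)).
    by move=> K; apply: mode_sum_linear.
  by move=> v; have [d dv] := degle_exists v; apply: YE dv.
have [K E] := YE _ _ p Dv; rewrite (E K) //.
apply: (degle_le (mode_sum_graded b o K gY p Dv)).
by rewrite /swt big_cons; lia.
Qed.

Lemma Yseq_linear b s p : linear (Yseq b s ^~ p).
Proof. by case: (Yseq_linear_graded b s). Qed.

Lemma Yseq_graded b s : is_graded (swt s)%:Z (Yseq b s).
Proof. by case: (Yseq_linear_graded b s). Qed.

Lemma Yseq_cons b o s (D p : int) (K : nat) v : degle D v ->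
  D < K%:Z -> D + p + (swt (o :: s))%:Z < K%:Z ->
  Yseq b (o :: s) v p = mode_sum b o K (Yseq b s) v p.
Proof.
move=> Dv DK DpK; apply: (normal_order_mode_sum _ _ _ Dv DK _).
- exact: Yseq_linear.
- exact: Yseq_graded.
by move: DpK; rewrite /swt big_cons; lia.
Qed.

End VertexOperators.

(** * The field of a vector of M^l *)

Section StateField.
Variables (C : numFieldType) (l : nat).
Local Notation osc := (osc l).
Local Notation Ml := (Ml C l).
Local Notation mon := (vmon C l).
Local Notation monom := {cmonom osc}.
Local Notation Cl := 'rV[C]_l.
Implicit Types (b : Cl) (i : 'I_l) (m : monom) (v u : Ml) (s : seq osc) (o : osc).

Lemma Yseq_cons2 b o o' s (D p : int) (K : nat) v : degle D v ->
  D < K%:Z -> D + p + (swt (o :: o' :: s))%:Z < K%:Z ->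
  Yseq b (o :: o' :: s) v p =
  \sum_(n <- modes K) \sum_(n' <- modes K)
    (dcoef C o.2 n * dcoef C o'.2 n') *:
    lmode o.1 n (lmode o'.1 n' (Yseq b s (rmode b o'.1 n' (rmode b o.1 n v))
      (p + n + o.2.+1%:Z + n' + o'.2.+1%:Z))).
Proof.
move=> Dv DK DpK; rewrite (Yseq_cons _ Dv DK DpK) /mode_sum.
apply: eq_bigr => n _; have [D' [D'v D'D D'n]] := rmode_degle b o.1 n Dv.
have D'K : D' < K%:Z by lia.
have pK : D' + (p + n + o.2.+1%:Z) + (swt (o' :: s))%:Z < K%:Z.
  by move: DpK; rewrite /swt !big_cons; lia.
rewrite (Yseq_cons _ D'v D'K pK) /mode_sum.
rewrite (lin_sum (lmode_linear _ _)) scaler_sumr; apply: eq_bigr => n' _.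
by rewrite (lin_scale (lmode_linear _ _)) scalerA.
Qed.

(** The order of the factors is immaterial because the modes n < 0 commute among
    themselves, and so do the modes n >= 0. *)
Lemma Yseq_swap b o o' s : Yseq b (o :: o' :: s) = Yseq b (o' :: o :: s).
Proof.
apply/funext => v; apply/funext => p; have [d dv] := degle_exists v.
pose K := (d + absz p + swt (o :: o' :: s)).+1.
have swtC : swt (o' :: o :: s) = swt (o :: o' :: s).
  by rewrite /swt !big_cons addnCA.
have dK : d%:Z < K%:Z by lia.
have pK : d%:Z + p + (swt (o :: o' :: s))%:Z < K%:Z by lia.
have pK' : d%:Z + p + (swt (o' :: o :: s))%:Z < K%:Z by rewrite swtC.
rewrite (Yseq_cons2 _ dv dK pK) (Yseq_cons2 _ dv dK pK').
rewrite [LHS]exchange_sum.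
apply: eq_bigr => n _.
apply: eq_bigr => n' _.
rewrite [dcoef _ _ _ * _]mulrC.
rewrite lmode_comm.
rewrite (rmode_comm b b).
have -> : p + n' + o.2.+1%:Z + n + o'.2.+1%:Z
  = p + n + o'.2.+1%:Z + n' + o.2.+1%:Z by lia.
exact: erefl.
Qed.

Lemma Yseq_congr b o s s' :
  Yseq b s = Yseq b s' -> Yseq b (o :: s) = Yseq b (o :: s').
Proof. by move=> E; rewrite [LHS]/= E; exact: erefl. Qed.

Lemma Yseq_perm b s s' : perm_eq s s' -> Yseq b s = Yseq b s'.
Proof.
elim: s s' => [|o s IH] s' ss'.
  by move: (perm_size ss') => /esym/size0nil ->.
have /splitPr E : o \in s' by rewrite -(perm_mem ss') mem_head.
case: E ss' => t t' ss'.
have -> : Yseq b (t ++ o :: t') = Yseq b (o :: t ++ t').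
  elim: t {ss'} => [|o' t IHt]; first exact: erefl.
  rewrite [RHS]Yseq_swap; exact: Yseq_congr.
have /IH E : perm_eq s (t ++ t').
  rewrite -(perm_cons o); apply: perm_trans ss' _.
  by rewrite perm_catC /= perm_cons perm_catC.
exact: Yseq_congr.
Qed.

Lemma count_factors m o : count_mem o (factors m) = m o.
Proof.
rewrite /factors count_flatten -map_comp sumnE big_map.
under eq_bigr do rewrite /= count_nseq /=.
have [om|om] := boolP (o \in finsupp m).
  rewrite (bigD1_seq o) ?fset_uniq //= eqxx mul1n big1 ?addn0 // => q /negbTE ->.
  by rewrite mul0n.
rewrite big1_seq => [|q /= qm].
  by apply/esym/eqP; rewrite cmE_eq0.
by case: eqP => // qo; rewrite -qo qm in om.
Qed.

Lemma perm_factors m s : (forall o, count_mem o s = m o) -> perm_eq (factors m) s.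
Proof. by move=> H; apply/allP => o _ /=; rewrite count_factors H. Qed.

Lemma perm_factorsM o m : perm_eq (factors (mmul (ucm o) m)) (o :: factors m).
Proof. by apply: perm_factors => q; rewrite /= count_factors cmM cmU. Qed.

Lemma swt_factors m : swt (factors m) = mwt m.
Proof.
rewrite /swt /factors big_flatten big_map /mwt; apply: eq_bigr => o _.
by rewrite big_nseq iter_addn_0 mulnC.
Qed.

Lemma Yop_linear_l b v p : linear (fun u => Yop b u v p).
Proof.
by move=> c x y; rewrite /Yop (malg_sumD (fun m => Yseq b (factors m) v p)) malg_sumZ.
Qed.

Lemma YopP b c x y v p :
  Yop b (c *: x + y) v p = c *: Yop b x v p + Yop b y v p.
Proof. exact: Yop_linear_l. Qed.

Lemma Yop_mon b m : Yop b (mon m) = Yseq b (factors m).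
Proof.
apply/funext => v; apply/funext => p.
exact: (malg_sumU (fun m => Yseq b (factors m) v p)).
Qed.

Lemma Yop_linear b u p : linear (Yop b u ^~ p).
Proof.
apply: linear_big => m; apply: linear_scaled; exact: Yseq_linear.
Qed.

Lemma Yop_graded b (h : int) u : degle h u -> is_graded h (Yop b u).
Proof.
move=> hu D p v Dv; apply: (degle_lin (Yop_linear_l b v p) _ hu) => m mh.
rewrite Yop_mon; apply: (degle_le (Yseq_graded b (factors m) p Dv)).
by rewrite swt_factors; lia.
Qed.

Lemma mode_sum_Yop_linear b o K v p :
  linear (fun u => mode_sum b o K (Yop b u) v p).
Proof.
apply: linear_big => n; apply: linear_scaled => c x y.
by rewrite YopP lmode_linear.
Qed.

Lemma osc_varP o c (x y : Ml) :
  osc_var C o * (c *: x + y) = c *: (osc_var C o * x) + osc_var C o * y.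
Proof. by case: o => i k; exact: (heis_linear 0 i (Negz k) c x y). Qed.

(** Creating one more oscillator in u amounts to one more normally ordered
    product; this recursion is all that is used of the fields. *)
Lemma Yop_osc_var b o u (D h p : int) (K : nat) v : degle D v -> degle h u ->
  D < K%:Z -> D + p + h + o.2.+1%:Z < K%:Z ->
  Yop b (osc_var C o * u) v p = mode_sum b o K (Yop b u) v p.
Proof.
move=> Dv hu DK DpK; move: u hu; apply: degle_linear_eq => [c x y||m mh].
- by rewrite osc_varP YopP.
- exact: mode_sum_Yop_linear.
rewrite osc_var_mon !Yop_mon (Yseq_perm b (perm_factorsM o m)).
apply: (Yseq_cons _ Dv DK).
by rewrite /swt big_cons -/(swt _) swt_factors; lia.
Qed.

Lemma osc_var_degle (h : int) o u :
  degle h u -> degle (h + o.2.+1%:Z) (osc_var C o * u).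
Proof.
by case: o => i k /(heis_degle 0 i (Negz k)); rewrite NegzE opprK.
Qed.

End StateField.

(** * The exponentials Y_- and Y_+, and the product Y_- Y Y_+ *)

Section Exponentials.
Variables (C : numFieldType) (l : nat).
Local Notation osc := (osc l).
Local Notation Ml := (Ml C l).
Local Notation Cl := 'rV[C]_l.
Implicit Types (a b : Cl) (i : 'I_l) (v u w : Ml) (A : nat -> Ml -> Ml) (T : Ml -> Ml).

Lemma powcoef_linear A r p : (forall n, linear (A n)) -> linear (powcoef A r p).
Proof.
move=> lA; elim: r p => [|r IH] p; first by move=> c x y /=; rewrite mulrnDl scalerMnr.
by rewrite /=; apply: linear_big => n c x y; rewrite IH lA.
Qed.

Lemma expcoef_linear A p : (forall n, linear (A n)) -> linear (expcoef A p).
Proof.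
move=> lA; rewrite /expcoef; apply: linear_big => r; apply: linear_scaled.
exact: powcoef_linear.
Qed.

Lemma powcoef_degle (e : int) A r p (D : int) v :
  (forall n (D : int) v, degle D v -> degle (D + e * n%:Z) (A n v)) ->
  degle D v -> degle (D + e * p%:Z) (powcoef A r p v).
Proof.
move=> gA Dv; elim: r p => [|r IH] p /=.
  by case: p => [|p]; rewrite ?mulr0 ?addr0 ?mulr1n // mulr0n; exact: degle0.
rewrite big_seq; apply: degle_sum => n; rewrite mem_index_iota => np.
apply: (degle_le (gA n _ _ (IH (p - n)%N))).
by rewrite -addrA -mulrDr -PoszD subnK //; lia.
Qed.

Lemma expcoef_degle (e : int) A p (D : int) v :
  (forall n (D : int) v, degle D v -> degle (D + e * n%:Z) (A n v)) ->
  degle D v -> degle (D + e * p%:Z) (expcoef A p v).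
Proof.
by move=> gA Dv; apply: degle_sum => r _; apply: degleZ; exact: powcoef_degle.
Qed.

Lemma powcoef_comm A T r p v : linear T ->
  (forall n v, (0 < n)%N -> T (A n v) = A n (T v)) ->
  T (powcoef A r p v) = powcoef A r p (T v).
Proof.
move=> lT TA; elim: r p => [|r IH] p /=.
  case: (p == 0%N); first exact: erefl.
  exact: lin0.
rewrite (lin_sum lT); apply: eq_big_nat => n /andP[n0 _].
by rewrite TA // IH.
Qed.

Lemma expcoef_comm A T p v : linear T ->
  (forall n v, (0 < n)%N -> T (A n v) = A n (T v)) ->
  T (expcoef A p v) = expcoef A p (T v).
Proof.
move=> lT TA; rewrite /expcoef (lin_sum lT); apply: eq_bigr => r _.
by rewrite (lin_scale lT) powcoef_comm.
Qed.

Lemma expcoef_zero A p v : (forall n w, A n w = 0) ->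
  expcoef A p v = v *+ (p == 0%N).
Proof.
move=> A0; rewrite /expcoef big_ord_recl big1 => [|r _].
  by rewrite /= invr1 scale1r addr0.
by rewrite /= big1_seq ?scaler0 // => j _; exact: A0.
Qed.

Lemma amode_linear b a n : linear (amode b a n).
Proof.
rewrite /amode; apply: linear_big => i; apply: linear_scaled.
exact: heis_linear.
Qed.

Lemma amode_degle b a (n D : int) v :
  degle D v -> degle (D - n) (amode b a n v).
Proof.
by move=> Dv; apply: degle_sum => i _; apply: degleZ; exact: heis_degle.
Qed.

Lemma amode_comm b a T (n : int) v : linear T ->
  (forall i v, T (heis b i n v) = heis b i n (T v)) ->
  T (amode b a n v) = amode b a n (T v).
Proof.
move=> lT Th; rewrite /amode (lin_sum lT); apply: eq_bigr => i _.
by rewrite (lin_scale lT) Th.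
Qed.

Definition ymcoef b a (n : nat) w : Ml := n%:R^-1 *: amode b a (- n%:Z) w.
Definition ypcoef b a (n : nat) w : Ml := - n%:R^-1 *: amode b a n%:Z w.

End Exponentials.

(** The coefficients of z^n in Y_-(a, z) and of z^(-n) in Y_+(a, z) on M_b. *)
HB.lock Definition ym (C : numFieldType) (l : nat) (b a : 'rV[C]_l) (n : nat)
  (v : Ml C l) : Ml C l := expcoef (ymcoef b a) n v.
HB.lock Definition yp (C : numFieldType) (l : nat) (b a : 'rV[C]_l) (n : nat)
  (v : Ml C l) : Ml C l := expcoef (ypcoef b a) n v.

Section NormalOrderedProduct.
Variables (C : numFieldType) (l : nat).
Local Notation osc := (osc l).
Local Notation Ml := (Ml C l).
Local Notation Cl := 'rV[C]_l.
Implicit Types (a b : Cl) (i : 'I_l) (v u w : Ml).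

Lemma Yminus_nat b a v (n : nat) : Yminus b a v n%:Z = ym b a n v.
Proof. by rewrite ym.unlock. Qed.

Lemma Yminus_lt0 b a v (q : int) : q < 0 -> Yminus b a v q = 0.
Proof. by rewrite /Yminus leNgt => ->. Qed.

Lemma Yplus_nat b a v (n : nat) : Yplus b a v (- n%:Z) = yp b a n v.
Proof. by rewrite yp.unlock /Yplus oppr_le0 abszN. Qed.

Lemma Yplus_gt0 b a v (q : int) : 0 < q -> Yplus b a v q = 0.
Proof. by rewrite /Yplus leNgt => ->. Qed.

Lemma ymcoef_linear b a n : linear (ymcoef b a n).
Proof. exact/linear_scaled/amode_linear. Qed.

Lemma ypcoef_linear b a n : linear (ypcoef b a n).
Proof. exact/linear_scaled/amode_linear. Qed.

Lemma ym_linear b a n : linear (ym b a n).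
Proof.
by rewrite ym.unlock; apply: expcoef_linear => k; exact: ymcoef_linear.
Qed.

Lemma yp_linear b a n : linear (yp b a n).
Proof.
by rewrite yp.unlock; apply: expcoef_linear => k; exact: ypcoef_linear.
Qed.

Lemma ym_degle b a (n : nat) (D : int) v :
  degle D v -> degle (D + n%:Z) (ym b a n v).
Proof.
move=> Dv; rewrite ym.unlock -[n%:Z]mul1r; apply: expcoef_degle Dv => k E x Ex.
by apply: degleZ; apply: (degle_le (amode_degle b a (- k%:Z) Ex)); lia.
Qed.

Lemma yp_degle b a (n : nat) (D : int) v :
  degle D v -> degle (D - n%:Z) (yp b a n v).
Proof.
move=> Dv; rewrite yp.unlock -[- n%:Z]mulN1r; apply: expcoef_degle Dv => k E x Ex.
by apply: degleZ; apply: (degle_le (amode_degle b a k%:Z Ex)); lia.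
Qed.

Lemma ym_lmode b a n i (k : int) v :
  lmode i k (ym b a n v) = ym b a n (lmode i k v).
Proof.
rewrite ym.unlock; apply: expcoef_comm => [|j x j0]; first exact: lmode_linear.
rewrite /ymcoef (lin_scale (lmode_linear _ _)); congr (_ *: _).
apply: amode_comm => [|i' y]; first exact: lmode_linear.
rewrite /lmode; case: ltrP => [k0|_]; last exact: erefl.
rewrite heis_comm; have -> : (k + - j%:Z == 0) = false by lia.
by rewrite andbF mulr0n scale0r addr0.
Qed.

Lemma yp_rmode b a n i (k : int) v :
  rmode b i k (yp b a n v) = yp b a n (rmode b i k v).
Proof.
rewrite yp.unlock; apply: expcoef_comm => [|j x j0]; first exact: rmode_linear.
rewrite /ypcoef (lin_scale (rmode_linear _ _ _)); congr (_ *: _).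
apply: amode_comm => [|i' y]; first exact: rmode_linear.
rewrite /rmode; case: ltrP => [_|k0]; first exact: erefl.
rewrite heis_comm; have -> : (k + j%:Z == 0) = false by lia.
by rewrite andbF mulr0n scale0r addr0.
Qed.

(** The composition Y_-(a, z) Y(u, z) Y_+(a, z) with both exponentials cut off at
    order M. *)
Definition Ynorm_window a u b (M : nat) v (p : int) : Ml :=
  \sum_(n1 <- iota 0 M) \sum_(n2 <- iota 0 M)
    ym b a n1 (Yop b u (yp b a n2 v) (p - n1%:Z + n2%:Z)).

Lemma YopYplus_window a u b (M : nat) v (D q : int) :
  degle D v -> D < M%:Z ->
  fcomp (Yop b u) (Yplus b a) v q
  = \sum_(n <- iota 0 M) Yop b u (yp b a n v) (q + n%:Z).
Proof.
move=> Dv DM; rewrite /fcomp.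
rewrite (fsum_inj (f := fun n : nat => - n%:Z) (s := iota 0 M)); last 3 first.
- by move=> x y; lia.
- exact: iota_uniq.
- move=> q' qM; have [q0|q0] := ltrP 0 q'.
    by rewrite Yplus_gt0 // (lin0 (Yop_linear _ _ _)).
  have qE : q' = - (absz q')%:Z by lia.
  rewrite qE Yplus_nat (degle_lt0 _ (yp_degle b a _ Dv)) ?(lin0 (Yop_linear _ _ _)) //.
  rewrite subr_lt0; apply: lt_le_trans DM _; rewrite lez_nat leqNgt.
  by apply: contra qM => qM; apply/mapP; exists (absz q'); rewrite ?mem_iota.
by apply: eq_bigr => n _; rewrite Yplus_nat opprK.
Qed.

Lemma Ynorm_windowE a u b (M : nat) v (D h p : int) : degle D v -> degle h u ->
  D < M%:Z -> D + p + h < M%:Z ->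
  Ynorm a u b v p = Ynorm_window a u b M v p.
Proof.
move=> Dv hu DM DpM.
have -> : Ynorm a u b v p = \sum_(q \in [set: int])
    Yminus b a (fcomp (Yop b u) (Yplus b a) v q) (p - q) by exact: erefl.
rewrite (fsum_inj (f := fun n : nat => p - n%:Z) (s := iota 0 M)); last 3 first.
- by move=> x y; lia.
- exact: iota_uniq.
- move=> q qM; have [q0|q0] := ltrP (p - q) 0; first by rewrite Yminus_lt0.
  have -> : p - q = (absz (p - q))%:Z by lia.
  rewrite Yminus_nat (YopYplus_window _ _ _ _ Dv DM) big1 ?(lin0 (ym_linear _ _ _)) //.
  move=> n _; apply: (degle_lt0 _ (Yop_graded b hu (q + n%:Z) (yp_degle b a n Dv))).
  suff : ((M <= absz (p - q))%N) by lia.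
  rewrite leqNgt; apply: contra qM => qM; apply/mapP.
  by exists (absz (p - q)); rewrite ?mem_iota //; lia.
apply: eq_bigr => n _; have -> : p - (p - n%:Z) = n%:Z by lia.
rewrite Yminus_nat (YopYplus_window _ _ _ _ Dv DM).
exact: (lin_sum (ym_linear _ _ _)).
Qed.

Lemma Ynorm_window_ex a u b v (p : int) : exists M0, forall M, (M0 <= M)%N ->
  Ynorm a u b v p = Ynorm_window a u b M v p.
Proof.
have [d dv] := degle_exists v; have [h hu] := degle_exists u.
exists (d + absz p + h).+1%N => M MM.
by apply: (Ynorm_windowE _ _ dv hu); lia.
Qed.

Lemma Ynorm_linear a u b p : linear (Ynorm a u b ^~ p).
Proof.
apply: (linear_eventually (g := fun M v => Ynorm_window a u b M v p)); last first.
  by move=> v; exact: Ynorm_window_ex.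
move=> M; apply: linear_big => n1; apply: linear_big => n2 c x y.
have YP q z t : Yop b u (c *: z + t) q = c *: Yop b u z q + Yop b u t q.
  exact: Yop_linear.
by rewrite yp_linear YP ym_linear.
Qed.

Lemma Ynorm_linear_l a b v p : linear (fun u => Ynorm a u b v p).
Proof.
apply: (linear_eventually (g := fun M u => Ynorm_window a u b M v p)); last first.
  by move=> u; exact: Ynorm_window_ex.
move=> M; apply: linear_big => n1; apply: linear_big => n2 c x y.
by rewrite YopP ym_linear.
Qed.

(** Y_- commutes with the creation operators and Y_+ with the other modes, so the
    recursion for Y(u, z) passes to Y_- Y Y_+. The cut-off for v also serves the
    vectors met on the way: Y_+ lowers the weight by as much as the exponent of
    z moves up. *)
Lemma Ynorm_osc_var a u b o (D h p : int) (K : nat) v :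
  degle D v -> degle h u -> D < K%:Z -> D + p + h + o.2.+1%:Z < K%:Z ->
  Ynorm a (osc_var C o * u) b v p = mode_sum b o K (Ynorm a u b) v p.
Proof.
move=> Dv hu DK DpK.
have pK : D + p + (h + o.2.+1%:Z) < K%:Z by rewrite addrA.
rewrite (Ynorm_windowE a b Dv (osc_var_degle o hu) DK pK).
rewrite /Ynorm_window.
transitivity (\sum_(n1 <- iota 0 K) \sum_(n2 <- iota 0 K) \sum_(n <- modes K)
  dcoef C o.2 n *: lmode o.1 n (ym b a n1 (Yop b u
    (yp b a n2 (rmode b o.1 n v)) (p + n + o.2.+1%:Z - n1%:Z + n2%:Z)))).
  apply: eq_bigr => n1 _; apply: eq_bigr => n2 _.
  have DK2 : D - n2%:Z < K%:Z by lia.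
  have pK2 : D - n2%:Z + (p - n1%:Z + n2%:Z) + h + o.2.+1%:Z < K%:Z by lia.
  rewrite (Yop_osc_var b (yp_degle b a n2 Dv) hu DK2 pK2) /mode_sum.
  rewrite (lin_sum (ym_linear _ _ _)); apply: eq_bigr => n _.
  rewrite (lin_scale (ym_linear _ _ _)) -ym_lmode yp_rmode.
  have -> : p - n1%:Z + n2%:Z + n + o.2.+1%:Z
    = p + n + o.2.+1%:Z - n1%:Z + n2%:Z by lia.
  exact: erefl.
under eq_bigr => n1 _ do rewrite exchange_sum.
rewrite exchange_sum; apply: eq_bigr => n _.
have [D' [D'v D'D D'n]] := rmode_degle b o.1 n Dv.
have D'K : D' < K%:Z by lia.
have pK' : D' + (p + n + o.2.+1%:Z) + h < K%:Z by lia.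
rewrite (Ynorm_windowE a b D'v hu D'K pK') /Ynorm_window.
rewrite (lin_sum (lmode_linear _ _)) scaler_sumr; apply: eq_bigr => n1 _.
by rewrite (lin_sum (lmode_linear _ _)) scaler_sumr.
Qed.

End NormalOrderedProduct.

(** * Binomial coefficients and triangular sums *)

Section BinomialIdentity.
Variable C : numFieldType.

Lemma dcoef0 n : dcoef C 0 n = 1.
Proof. by case: n => j; rewrite /dcoef ?bin0 // expr0 mul1r. Qed.

Lemma dcoef_pascal r (n : int) :
  dcoef C r.+1 (n - 1) = dcoef C r.+1 n + dcoef C r n.
Proof.
case: n => [[|j]|j].
- have -> : 0%:Z - 1 = Negz 0 by [].
  by rewrite /dcoef bin0n !add0n !binn !mulr1 exprS mulN1r addNr.
- have -> : j.+1%:Z - 1 = j by lia.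
  rewrite /dcoef [in X in _ + X]addSnnS addSn binS natrD exprS; ring.
- have -> : Negz j - 1 = Negz j.+1 by lia.
  by rewrite /dcoef binS natrD.
Qed.

(** [dcoef k n] is the coefficient of x^k in (1 + x)^(- n - 1), and
    multiplication by (1 + x)^M shifts n by - M. *)
Lemma dcoef_vandermonde M (n : int) k :
  \sum_(j < k.+1) 'C(M, j)%:R * dcoef C (k - j) n = dcoef C k (n - M%:Z).
Proof.
elim: M n => [|M IH] n.
  rewrite big_ord_recl bin0 mul1r subn0 subr0 big1 ?addr0 // => j _.
  by rewrite bin0n mul0r.
have -> : n - M.+1%:Z = n - 1 - M%:Z by lia.
rewrite -IH big_ord_recl bin0 mul1r subn0.
transitivity (\sum_(j < k.+1) 'C(M, j)%:R * dcoef C (k - j) n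
    + \sum_(j < k) 'C(M, j)%:R * dcoef C (k - j.+1) n).
  rewrite [in RHS]big_ord_recl bin0 mul1r subn0 -addrA -big_split /=.
  congr (_ + _); apply: eq_bigr => j _.
  by rewrite /bump leq0n add1n binS natrD mulrDl.
rewrite big_ord_recr [in RHS]big_ord_recr /= subnn !dcoef0 addrAC -big_split /=.
congr (_ + _); apply: eq_bigr => j _; rewrite -mulrDr.
by rewrite -[in RHS](subnSK (ltn_ord j)) dcoef_pascal subnSK.
Qed.

(** The reflection binom(- x, k) = (-1)^k binom(x + k - 1, k). *)
Lemma dcoef_reflect k (n : int) :
  dcoef C k (n - k.+1%:Z) = (-1) ^+ k * dcoef C k (- n).
Proof.
have [n0|n0] := lerP n 0.
  pose j := absz n.
  have -> : n - k.+1%:Z = Negz (j + k) by rewrite /j; lia.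
  have -> : - n = j by rewrite /j; lia.
  by rewrite /dcoef mulrA -exprMn mulrNN mulr1 expr1n mul1r.
pose j := (absz n).-1.
have -> : - n = Negz j by rewrite /j; lia.
have [kj|jk] := leqP k j.
  have -> : n - k.+1%:Z = (j - k)%N by rewrite /j; lia.
  by rewrite /dcoef subnK.
have -> : n - k.+1%:Z = Negz (k - j).-1 by rewrite /j; lia.
rewrite /dcoef !bin_small ?mulr0 //; lia.
Qed.

(** What makes the recursion for the adjoint field agree with the adjoint of the
    recursion for the field: mode by mode, the conjugation by exp(L(1)) has the
    effect of exchanging a^i(n) and a^i(-n) up to a common sign. *)
Lemma dcoef_translation k (n : int) :
  \sum_(j < k.+1) 'C(k.+1, j)%:R * dcoef C (k - j) n
  = (-1) ^+ k * dcoef C k (- n).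
Proof. by rewrite dcoef_vandermonde dcoef_reflect. Qed.

End BinomialIdentity.

Lemma triangle_sum (V : nmodType) (f : nat -> nat -> V) R :
  \sum_(r < R) \sum_(j < r.+1) f j (r - j)%N
  = \sum_(j < R) \sum_(r < R - j) f j r.
Proof.
elim: R => [|R IH]; first by rewrite !big_ord0.
rewrite big_ord_recr [RHS]/= IH.
transitivity (\sum_(j < R.+1) \sum_(r < R - j) f j r
    + \sum_(j < R.+1) f j (R - j)%N).
  by congr (_ + _); rewrite [RHS]big_ord_recr /= subnn big_ord0 addr0.
rewrite -big_split; apply: eq_bigr => j _.
by rewrite subSn ?leq_ord // big_ord_recr.
Qed.

Lemma triangle_sum_square (V : nmodType) (f : nat -> nat -> V) R M :
  (forall j r, (R <= j + r)%N || (M < j)%N -> f j r = 0) -> (M < R)%N ->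
  \sum_(r < R) \sum_(j < r.+1) f j (r - j)%N
  = \sum_(j < M.+1) \sum_(r < R) f j r.
Proof.
move=> f0 MR; rewrite triangle_sum.
rewrite -!(big_mkord xpredT (fun j => \sum_(r < _ - j) f j r)).
rewrite -!(big_mkord xpredT (fun j => \sum_(r < _) f j r)).
rewrite (big_cat_nat (n := M.+1)) //= [X in _ + X]big1_seq ?addr0 => [|j]; last first.
  rewrite mem_index_iota => /= /andP[Mj _]; apply: big1 => r _.
  by apply: f0; rewrite Mj orbT.
apply: eq_big_nat => j /andP[_ jM].
rewrite -!(big_mkord xpredT (f j)) [RHS](big_cat_nat (n := R - j)) ?leq_subr //=.
rewrite [X in _ + X]big1_seq ?addr0 // => r.
by rewrite mem_index_iota => /andP[_ /andP[H _]]; apply: f0; rewrite -leq_subLR H.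
Qed.

(** * The operator L(1) and its divided powers *)

Section DividedPowers.
Variables (C : numFieldType) (V : lmodType C).

Definition divpow (L : V -> V) (r : nat) (u : V) : V := r`!%:R^-1 *: iter r L u.

Variables (L : V -> V) (lL : linear L).

Lemma divpow_linear r : linear (divpow L r).
Proof.
apply: linear_scaled; elim: r => [|r IH] c x y; first exact: erefl.
by rewrite !iterS IH lL.
Qed.

Lemma divpow0 u : divpow L 0 u = u.
Proof. by rewrite /divpow /= fact0 invr1 scale1r. Qed.

Lemma divpowS r u : r.+1%:R *: divpow L r.+1 u = L (divpow L r u).
Proof.
rewrite /divpow (lin_scale lL) scalerA iterS; congr (_ *: _).
by rewrite factS natrM invfM mulrA divff ?mul1r // pnatr_eq0.
Qed.

(** If [L, H(-q)] = q H(1-q) then exp(L) H(-m) = sum_j binom(m, j) H(j-m) exp(L).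
    In the induction on r both sides are multiplied by r + 1 = (r + 1 - j) + j:
    the first part comes from L reaching u, the second from its commutator with
    H, by binom(m, j) (m - j) = (j + 1) binom(m, j + 1). *)
Lemma divpow_raise (H : int -> V -> V) (m r : nat) u :
  (forall n, linear (H n)) ->
  (forall (q : nat) v,
     L (H (- q%:Z) v) = H (- q%:Z) (L v) + q%:R *: H (1 - q%:Z) v) ->
  divpow L r (H (- m%:Z) u)
  = \sum_(j < r.+1) 'C(m, j)%:R *: H (j%:Z - m%:Z) (divpow L (r - j) u).
Proof.
move=> lH LH.
have step (j s : nat) : 'C(m, j)%:R *: L (H (j%:Z - m%:Z) (divpow L s u))
    = ('C(m, j) * s.+1)%:R *: H (j%:Z - m%:Z) (divpow L s.+1 u)
    + ('C(m, j.+1) * j.+1)%:R *: H (j.+1%:Z - m%:Z) (divpow L s u).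
  have [jm|mj] := leqP j m; last first.
    rewrite (bin_small mj) (bin_small (ltnW mj : (m < j.+1)%N)).
    by rewrite !mul0n !scale0r addr0.
  have -> : j%:Z - m%:Z = - (m - j)%N%:Z by lia.
  rewrite LH -divpowS (lin_scale (lH _)) scalerDr !scalerA.
  have -> : 1 - (m - j)%N%:Z = j.+1%:Z - m%:Z by lia.
  rewrite -!natrM; congr (_ + _ *: _).
  by rewrite [in RHS]mulnC mul_bin_left mulnC.
elim: r => [|r IH].
  rewrite big_ord_recl big_ord0 addr0 bin0 scale1r sub0r subn0.
  by rewrite !divpow0.
apply: (scalerI (a := r.+1%:R)); first by rewrite pnatr_eq0.
rewrite divpowS IH (lin_sum lL).
under eq_bigr => j _ do rewrite (lin_scale lL) step.
pose F (j : nat) := H (j%:Z - m%:Z) (divpow L (r.+1 - j) u).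
transitivity (\sum_(j < r.+2) (('C(m, j) * (r.+1 - j))%:R *: F j
  + ('C(m, j) * j)%:R *: F j)); last first.
  rewrite scaler_sumr; apply: eq_bigr => j _.
  rewrite -scalerDl -natrD -mulnDr subnK ?scalerA -?natrM; last by rewrite -ltnS.
  by rewrite mulnC.
rewrite !big_split /=; congr (_ + _).
  rewrite [RHS]big_ord_recr /= subnn muln0 scale0r addr0.
  by apply: eq_bigr => j _; rewrite /F subSn // -ltnS.
rewrite [RHS]big_ord_recl muln0 scale0r add0r.
by apply: eq_bigr => j _; rewrite /F /= /bump leq0n add1n subSS.
Qed.

End DividedPowers.

Section LowestVirasoroMode.
Variables (C : numFieldType) (l : nat).
Local Notation osc := (osc l).
Local Notation Ml := (Ml C l).
Local Notation mon := (vmon C l).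
Local Notation Cl := 'rV[C]_l.
Implicit Types (a b : Cl) (i j : 'I_l) (v u w : Ml).

Lemma vmon1 : mon mone = 1.
Proof. by apply/malgP => m; rewrite mcoeff_vmon mcoeff1 eq_sym. Qed.

Lemma degle1 : degle 0 (1 : Ml).
Proof. by rewrite -vmon1; apply: degle_mon; rewrite mwt1. Qed.

Lemma omega_degle : degle 2 (omega C l).
Proof.
apply: degleZ; apply: degle_sum => i _; rewrite expr2.
have := osc_var_degle (i, 0%N) degle1; rewrite mulr1.
by move=> /(osc_var_degle (i, 0%N)).
Qed.

Lemma vir_linear a n : linear (vir a n).
Proof. exact: Yop_linear. Qed.

Lemma vir1_degle a (D : int) v : degle D v -> degle (D - 1) (vir a 1 v).
Proof.
move=> Dv; apply: (degle_le (Yop_graded a omega_degle (- 1 - 2%:Z) Dv)); lia.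
Qed.

(** L(1) is half the sum over i and n of : a^i(n) a^i(1 - n) :. *)
Definition quad_mode a i (n : int) v : Ml :=
  lmode i n (heis a i (1 - n) (rmode a i n v)).

Lemma vir1_modes a v : exists K0, forall K, (K0 <= K)%N ->
  vir a 1 v = 2%:R^-1 *: \sum_i \sum_(n <- modes K) quad_mode a i n v.
Proof.
have [d dv] := degle_exists v; exists d.+2 => K dK.
rewrite /vir Yop_omega; congr (_ *: _); apply: eq_bigr => i _.
have dK1 : d%:Z < K%:Z by lia.
have dK2 : d%:Z + (- 1 - 2%:Z) + (swt [:: (i, 0%N); (i, 0%N)])%:Z < K%:Z.
  by rewrite /swt !big_cons big_nil /=; lia.
rewrite (Yseq_cons _ dv dK1 dK2) /mode_sum; apply: eq_bigr => n _.
rewrite dcoef0 scale1r Yseq1 /quad_mode /=.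
by have -> : - (- 1 - 2%:Z + n + 1 + 1) = 1 - n by lia.
Qed.

Lemma quad_mode_lt0 a i n v : n < 0 ->
  quad_mode a i n v = heis a i n (heis a i (1 - n) v).
Proof.
by move=> n0; rewrite /quad_mode /lmode /rmode n0; apply: heis_indep; lia.
Qed.

Lemma quad_mode_ge0 a i n v : 0 <= n ->
  quad_mode a i n v = heis a i (1 - n) (heis a i n v).
Proof. by move=> n0; rewrite /quad_mode /lmode /rmode ltNge n0. Qed.

Lemma heis_comm2 a i j n k (q : int) v :
  heis a i n (heis a i k (heis a j q v))
  = heis a j q (heis a i n (heis a i k v))
    + ((n *+ ((i == j) && (n + q == 0)))%:~R *: heis a i k v
       + (k *+ ((i == j) && (k + q == 0)))%:~R *: heis a i n v).
Proof.
transitivity (heis a i n (heis a j q (heis a i k v))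
    + (k *+ ((i == j) && (k + q == 0)))%:~R *: heis a i n v).
  rewrite [X in heis a i n X](heis_comm a a i j k q v).
  rewrite (lin_add (heis_linear a i n)); apply: congr2; first exact: erefl.
  exact: (lin_scale (heis_linear a i n)).
by rewrite [X in X + _](heis_comm a a i j n q) -addrA.
Qed.

Lemma quad_mode_comm a i j n (q : nat) v :
  quad_mode a i n (heis a j (- q%:Z) v)
  = heis a j (- q%:Z) (quad_mode a i n v)
    + ((n *+ ((i == j) && (n - q%:Z == 0)))%:~R *: heis a i (1 - n) v
      + ((1 - n) *+ ((i == j) && (1 - n - q%:Z == 0)))%:~R *: heis a i n v).
Proof.
have [n0|n0] := ltrP n 0.
  rewrite (quad_mode_lt0 a i (heis a j (- q%:Z) v) n0).
  rewrite (quad_mode_lt0 a i v n0).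
  exact: heis_comm2.
rewrite (quad_mode_ge0 a i (heis a j (- q%:Z) v) n0) (quad_mode_ge0 a i v n0).
rewrite [X in _ = _ + X]addrC; exact: heis_comm2.
Qed.

(** The commutator of a^j(-q) with : a^j(n) a^j(1-n) : is q a^j(1-q) for n = q and
    again for n = 1 - q, which compensates the factor 1/2 of L(1). *)
Lemma vir1_heis a j (q : nat) v :
  vir a 1 (heis a j (- q%:Z) v)
  = heis a j (- q%:Z) (vir a 1 v) + q%:R *: heis a j (1 - q%:Z) v.
Proof.
have [K1 E1] := vir1_modes a v.
have [K2 E2] := vir1_modes a (heis a j (- q%:Z) v).
pose K := (K1 + K2 + q).+1.
rewrite (E1 K) ?(E2 K) ?/K; try lia.
rewrite (lin_scale (heis_linear a j _)) (lin_sum (heis_linear a j _)).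
pose c := q%:R *: heis a j (1 - q%:Z) v.
transitivity (2%:R^-1 *: \sum_i
  (heis a j (- q%:Z) (\sum_(n <- modes K) quad_mode a i n v)
   + (c *+ (i == j) + c *+ (i == j)))).
  congr (_ *: _); apply: eq_bigr => i _.
  rewrite (lin_sum (heis_linear a j _)).
  under eq_bigr do rewrite quad_mode_comm.
  rewrite !sum_split; apply: congr2; first exact: erefl.
  apply: congr2.
    rewrite (sum_modes1 (n0 := q%:Z)); [|lia|].
      rewrite subrr eqxx andbT; case: eqP => [->|_]; first by rewrite !mulr1n.
      by rewrite !mulr0n scale0r.
    move=> n nq; have -> : (n - q%:Z == 0) = false by lia.
    by rewrite andbF mulr0n scale0r.
  rewrite (sum_modes1 (n0 := 1 - q%:Z)); [|lia|].
    have -> : 1 - (1 - q%:Z) = q by lia.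
    rewrite subrr eqxx andbT; case: eqP => [->|_]; first by rewrite !mulr1n.
    by rewrite !mulr0n scale0r.
  move=> n nq; have -> : (1 - n - q%:Z == 0) = false by lia.
  by rewrite andbF mulr0n scale0r.
rewrite sum_split scalerDr; apply: congr2; first exact: erefl.
have -> : \sum_i (c *+ (i == j) + c *+ (i == j)) = c + c.
  rewrite (bigD1 j) //= eqxx big1 ?addr0 ?mulr1n => [|i /negbTE ->].
    exact: erefl.
  by rewrite addr0.
have two0 : 2%:R != 0 :> C by rewrite pnatr_eq0.
have -> : c + c = 2%:R *: c by rewrite scaler_nat mulr2n.
by rewrite scalerA (mulVf two0) scale1r.
Qed.

Lemma divpow_vir1_degle a r (D : int) u :
  degle D u -> degle (D - r%:Z) (divpow (vir a 1) r u).
Proof.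
move=> Du; apply: degleZ; elim: r => [|r IH]; first by rewrite subr0.
by rewrite iterS; apply: (degle_le (vir1_degle a IH)); lia.
Qed.

Lemma divpow_vir1_high a r (D : int) u :
  degle D u -> D < r%:Z -> divpow (vir a 1) r u = 0.
Proof.
move=> Du Dr; apply: (degle_lt0 _ (divpow_vir1_degle a r Du)).
by rewrite subr_lt0.
Qed.

Lemma divpow_vir1_heis a i (m r : nat) u :
  divpow (vir a 1) r (heis a i (- m%:Z) u)
  = \sum_(j < r.+1)
      'C(m, j)%:R *: heis a i (j%:Z - m%:Z) (divpow (vir a 1) (r - j) u).
Proof.
apply: (@divpow_raise _ _ _ (vir_linear a 1) (heis a i)) => [n|q v].
- exact: heis_linear.
- exact: vir1_heis.
Qed.

End LowestVirasoroMode.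

(** * The recursion for the adjoint field *)

(** The coefficient of z^t in the field of exp(z^(-1) L(1)) u, with L(1) acting
    on M_a. All terms with r beyond the weight of u vanish. *)
HB.lock Definition Ydiv (C : numFieldType) (l : nat) (a c : 'rV[C]_l)
    (u : Ml C l) (R : nat) (w : Ml C l) (t : int) : Ml C l :=
  \sum_(r < R) Ynorm a (divpow (vir a 1) r u) c w (r%:Z + t).

Section AdjointSeries.
Variables (C : numFieldType) (l : nat).
Local Notation osc := (osc l).
Local Notation Ml := (Ml C l).
Local Notation Cl := 'rV[C]_l.
Implicit Types (a b c : Cl) (i : 'I_l) (v u w : Ml).

Lemma Ydiv_linear a c u R t : linear (fun w => Ydiv a c u R w t).
Proof.
by rewrite Ydiv.unlock; apply: linear_big => r; exact: Ynorm_linear.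
Qed.

Lemma osc_var_heis b i k v : osc_var C (i, k) * v = heis b i (- k.+1%:Z) v.
Proof. by have -> : - k.+1%:Z = Negz k by lia. Qed.

(** By [divpow_raise], exp(L(1)) a^i(-k-1) u is a combination of the
    a^i(j-k-1) exp(L(1)) u. For j <= k each of them has a field given by
    [Ynorm_osc_var], and [dcoef_translation] adds up their coefficients; for
    j = k + 1 the operator is a^i(0), acting on M_a as a^i. *)
Lemma Ydiv_osc_var a c i k u (h R K : nat) (D t : int) w :
  degle h%:Z u -> degle D w -> (h + k.+1 < R)%N ->
  D < K%:Z -> D + t + h%:Z + k.+1%:Z < K%:Z ->
  Ydiv a c (osc_var C (i, k) * u) R w t
  = \sum_(n <- modes K) ((-1) ^+ k * dcoef C k (- n)) *:
      lmode i n (Ydiv a c u R (rmode c i n w) (t + n + k.+1%:Z))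
    + a 0 i *: Ydiv a c u R w (t + k.+1%:Z).
Proof.
rewrite Ydiv.unlock => hu Dw hR DK DtK; pose E r := divpow (vir a 1) r u.
have lY x t' : linear (fun z => Ynorm a z c x t') by exact: Ynorm_linear_l.
pose f (j r : nat) := 'C(k.+1, j)%:R *:
  Ynorm a (heis a i (j%:Z - k.+1%:Z) (E r)) c w (r%:Z + j%:Z + t).
have f0 j r : (R <= j + r)%N || (k.+1 < j)%N -> f j r = 0.
  have [kj _|jk] := ltnP k.+1 j; first by rewrite /f bin_small // scale0r.
  rewrite orbF => Rjr; rewrite /f /E (divpow_vir1_high a hu); last by lia.
  by rewrite heis0 (lin0 (lY _ _)) scaler0.
transitivity (\sum_(r < R) \sum_(j < r.+1) f j (r - j)%N).
  apply: eq_bigr => r _; rewrite (osc_var_heis a) divpow_vir1_heis.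
  rewrite (lin_sum (lY _ _)); apply: eq_bigr => j _.
  rewrite (lin_scale (lY _ _)) /f.
  have -> // : (r - j)%N%:Z + j%:Z + t = r%:Z + t.
  by have := ltn_ord j; lia.
rewrite (triangle_sum_square f0); last by lia.
rewrite big_ord_recr; apply: congr2; last first.
  rewrite scaler_sumr; apply: eq_bigr => r _.
  rewrite -[LHS]/(f k.+1 r) /f binn scale1r.
  have -> : k.+1%:Z - k.+1%:Z = 0 by lia.
  have -> : r%:Z + k.+1%:Z + t = r%:Z + (t + k.+1%:Z) by lia.
  by rewrite heis_zero; exact: (lin_scale (lY _ _)).
pose X (n : int) (r : nat) :=
  lmode i n (Ynorm a (E r) c (rmode c i n w) (r%:Z + (t + n + k.+1%:Z))).
transitivity (\sum_(j < k.+1) \sum_(n <- modes K) \sum_(r < R)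
    ('C(k.+1, j)%:R * dcoef C (k - j) n) *: X n r).
  apply: eq_bigr => j _; rewrite [RHS]exchange_sum; apply: eq_bigr => r _.
  have jk : (j <= k)%N by rewrite -ltnS.
  have -> : f j r = 'C(k.+1, j)%:R *:
      Ynorm a (osc_var C (i, (k - j)%N) * E r) c w (r%:Z + j%:Z + t).
    rewrite (osc_var_heis a) /f.
    by have -> : - (k - j).+1%:Z = j%:Z - k.+1%:Z by lia.
  have hE : degle (h%:Z - r%:Z) (E r) by exact: divpow_vir1_degle.
  have pK : D + (r%:Z + j%:Z + t) + (h%:Z - r%:Z) + (k - j).+1%:Z < K%:Z by lia.
  rewrite (Ynorm_osc_var a c (o := (i, (k - j)%N)) Dw hE DK pK) /mode_sum.
  rewrite scaler_sumr; apply: eq_bigr => n _; rewrite scalerA /X.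
  have -> // : r%:Z + j%:Z + t + n + (k - j).+1%:Z = r%:Z + (t + n + k.+1%:Z).
  lia.
rewrite exchange_sum; apply: eq_bigr => n _.
rewrite -dcoef_translation scaler_suml; apply: eq_bigr => j _.
rewrite (lin_sum (lmode_linear _ _)) scaler_sumr.
exact: erefl.
Qed.

End AdjointSeries.

(** * The form on M^l *)

Section MonomialInduction.
Variable l : nat.
Local Notation osc := (osc l).
Local Notation monom := {cmonom osc}.

Lemma monom_ind (P : monom -> Prop) : P mone ->
  (forall o m, P m -> P (mmul (ucm o) m)) -> forall m, P m.
Proof.
move=> P1 PU m; have [n] := ubnP (mdeg m); elim: n m => // n IH m mn.
have [->|m1] := eqVneq m mone; first exact: P1.
have [o om] : exists o, o \in finsupp m.
  apply/fset0Pn; apply: contra m1 => /eqP m0; apply/cmP => o.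
  by rewrite cm1; apply/eqP; rewrite cmE_eq0 m0 in_fset0.
have mE : m = mmul (ucm o) (divcm m (ucm o)).
  apply/eqP/cmP => q; rewrite cmM divcmE cmU; case: eqP => [<-|_].
    by rewrite subnKC // lt0n cmE_neq0.
  by rewrite subn0.
rewrite {1}mE; apply: PU; apply: IH.
by move: mn; rewrite {1}mE mdegM mdegU add1n ltnS.
Qed.

End MonomialInduction.

Definition onorm (C : numFieldType) (l : nat) (th : C) (o : osc l) (n : nat) : C :=
  (- th ^- o.2.+1 * o.2.+1%:R) ^+ n * n`!%:R.

Definition mnorm (C : numFieldType) (l : nat) (th : C) (m : {cmonom osc l}) : C :=
  \prod_(o <- finsupp m) onorm th o (m o).

(** Monomials are orthogonal, with norms such that the adjoint of a^i(-k) is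
    - th^(-k) a^i(k). For th = - lam^2 this is what invariance demands of the
    field of a^i(-1) 1. *)
HB.lock Definition hform (C : numFieldType) (l : nat) (th : C) (v w : Ml C l) : C :=
  \sum_(m <- msupp v) v@_m * w@_m * mnorm th m.

Section ContravariantForm.
Variables (C : numFieldType) (l : nat) (th : C).
Hypothesis th0 : th != 0.
Local Notation osc := (osc l).
Local Notation Ml := (Ml C l).
Local Notation mon := (vmon C l).
Local Notation monom := {cmonom osc}.
Local Notation Cl := 'rV[C]_l.
Implicit Types (a b c : Cl) (i : 'I_l) (v u w x y : Ml) (m : monom) (o : osc).
Local Notation onorm := (@onorm C l th).
Local Notation mnorm := (@mnorm C l th).
Local Notation hform := (@hform C l th).

Lemma onorm0 o : onorm o 0 = 1.
Proof. by rewrite /onorm fact0 expr0 mulr1. Qed.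

Lemma onormS o n :
  onorm o n.+1 = - th ^- o.2.+1 * (o.2.+1 * n.+1)%:R * onorm o n.
Proof. by rewrite /onorm exprS factS !natrM; ring. Qed.

Lemma onorm_neq0 o n : onorm o n != 0.
Proof.
apply: mulf_neq0; last by rewrite pnatr_eq0 -lt0n fact_gt0.
apply: expf_neq0; apply: mulf_neq0; last by rewrite pnatr_eq0.
by rewrite oppr_eq0 invr_eq0 expf_neq0.
Qed.

Lemma mnorm_widen (d : {fset osc}) m : (finsupp m `<=` d)%fset ->
  mnorm m = \prod_(o <- d) onorm o (m o).
Proof.
move=> md; apply: big_fset_incl => // o _.
by rewrite -cmE_eq0 => /eqP ->; rewrite onorm0.
Qed.

Lemma mnorm1 : mnorm mone = 1.
Proof. by rewrite /mnorm mdom1 big_seq_fset0. Qed.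

Lemma mnorm_neq0 m : mnorm m != 0.
Proof.
rewrite /mnorm; elim: (X in \prod_(o <- X) _) => [|o s IH].
  by rewrite big_nil oner_neq0.
by rewrite big_cons mulf_neq0 ?onorm_neq0.
Qed.

Lemma mnormU o m : mnorm (mmul (ucm o) m)
  = - th ^- o.2.+1 * (o.2.+1 * (m o).+1)%:R * mnorm m.
Proof.
pose d := (o |` finsupp m)%fset; have od : o \in d by rewrite !inE eqxx.
have md : (finsupp m `<=` d)%fset by exact: fsubsetUr.
rewrite (mnorm_widen md) (mnorm_widen (d := d)); last first.
  by rewrite mdomD mdomU.
rewrite !(bigD1_seq o) //= ?fset_uniq // cmM cmUU add1n onormS !mulrA.
by congr (_ * _); apply: eq_bigr => q /negbTE qo; rewrite cmM cmU eq_sym qo.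
Qed.

Lemma hform_widen (d : {fset monom}) v w : (msupp v `<=` d)%fset ->
  hform v w = \sum_(m <- d) v@_m * w@_m * mnorm m.
Proof.
rewrite hform.unlock => vd; apply: big_fset_incl => // m _ /mcoeff_outdom ->.
by rewrite !mul0r.
Qed.

Lemma hformC v w : hform v w = hform w v.
Proof.
pose d := (msupp v `|` msupp w)%fset.
rewrite (hform_widen (d := d)) ?fsubsetUl //.
rewrite (hform_widen (d := d) (v := w)) ?fsubsetUr //.
by apply: eq_bigr => m _; rewrite [v@_m * _]mulrC.
Qed.

Lemma hformPr (c : C) v w (z : Ml) : hform v (c *: w + z) = c * hform v w + hform v z.
Proof.
rewrite hform.unlock mulr_sumr -big_split; apply: eq_bigr => m _ /=.
by rewrite mcoeffD mcoeffZ; ring.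
Qed.

Lemma hformPl (c : C) v w (z : Ml) : hform (c *: w + z) v = c * hform w v + hform z v.
Proof. by rewrite hformC hformPr !(hformC v). Qed.

Lemma hform0r v : hform v 0 = 0.
Proof. by rewrite hform.unlock big1 // => m _; rewrite mcoeff0 mulr0 mul0r. Qed.

Lemma hform0l v : hform 0 v = 0.
Proof. by rewrite hformC hform0r. Qed.

Lemma hformZr (c : C) v w : hform v (c *: w) = c * hform v w.
Proof. by rewrite -[c *: w]addr0 hformPr hform0r addr0. Qed.

Lemma hformZl (c : C) v w : hform (c *: v) w = c * hform v w.
Proof. by rewrite hformC hformZr hformC. Qed.

Lemma hformDr v w (z : Ml) : hform v (w + z) = hform v w + hform v z.
Proof. by rewrite -[w]scale1r hformPr scale1r mul1r. Qed.

Lemma hform_sumr v (I : Type) (r : seq I) (F : I -> Ml) :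
  hform v (\sum_(i <- r) F i) = \sum_(i <- r) hform v (F i).
Proof. by apply: big_morph; [exact: hformDr | exact: hform0r]. Qed.

Lemma hform_suml v (I : Type) (r : seq I) (F : I -> Ml) :
  hform (\sum_(i <- r) F i) v = \sum_(i <- r) hform (F i) v.
Proof. by rewrite hformC hform_sumr; apply: eq_bigr => i _; rewrite hformC. Qed.

Lemma hform_monl m w : hform (mon m) w = w@_m * mnorm m.
Proof.
rewrite (hform_widen (d := [fset m]%fset)).
  by rewrite big_seq_fset1 mcoeff_vmon eqxx mul1r.
by rewrite vmon.unlock msuppU1.
Qed.

Lemma hform1 : hform 1 1 = 1.
Proof. by rewrite -vmon1 hform_monl mcoeff_vmon eqxx mnorm1 mulr1. Qed.

Lemma hform_mon m m' : hform (mon m) (mon m') = (m' == m)%:R * mnorm m.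
Proof. by rewrite hform_monl mcoeff_vmon. Qed.

Lemma hform_nondegenerate v : (forall w, hform v w = 0) -> v = 0.
Proof.
move=> v0; apply/malgP => m; have := v0 (mon m).
rewrite hformC hform_monl mcoeff0 => /eqP.
by rewrite mulf_eq0 (negbTE (mnorm_neq0 m)) orbF => /eqP.
Qed.

Lemma hform_ext (f g : Ml -> C) :
  (forall (c : C) x y, f (c *: x + y) = c * f x + f y) ->
  (forall (c : C) x y, g (c *: x + y) = c * g x + g y) ->
  (forall m, f (mon m) = g (mon m)) -> forall v, f v = g v.
Proof. by move=> lf lg; exact: (@lin_mon_ext C l C^o f g lf lg). Qed.

Lemma hform_osc_var o v w :
  hform (osc_var C o * v) w = - th ^- o.2.+1 * hform v (heis 0 o.1 o.2.+1 w).
Proof.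
move: w; apply: hform_ext => [d x y|d x y|m'].
- by rewrite hformPr.
- by rewrite heis_linear hformPr mulrDr mulrCA.
move: v; apply: hform_ext => [d x y|d x y|m].
- by rewrite osc_varP hformPl.
- by rewrite hformPl mulrDr mulrCA.
rewrite osc_var_mon heis_posU hformZr !hform_mon mnormU -surjective_pairing.
have [E|ne] := eqVneq (divcm m' (ucm o)) m.
  have [mo|mo] := posnP (m' o).
    rewrite mo muln0 mul0r mulr0.
    have -> : (m' == mmul (ucm o) m) = false.
      by apply/eqP => /(congr1 (fun m : monom => m o)); rewrite mo cmM cmUU.
    by rewrite mul0r.
  have -> : m' = mmul (ucm o) m.
    apply/eqP/cmP => q; rewrite -E cmM divcmE cmU; case: eqP => [<-|_].
      by rewrite subnKC.
    by rewrite subn0.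
  rewrite eqxx cmM cmUU add1n; ring.
have -> : (m' == mmul (ucm o) m) = false.
  apply/negbTE; apply: contra ne => /eqP ->; apply/cmP => q.
  by rewrite divcmE cmM addnC addnK.
by rewrite !mul0r !mulr0.
Qed.

Lemma hform_heis b c i (n : int) v w : n != 0 ->
  hform (heis b i n v) w = - th ^ n * hform v (heis c i (- n) w).
Proof.
case: n => [[|k] n0|k _].
- by case/eqP: n0.
- have E := hform_osc_var (i, k) w v.
  rewrite -(osc_var_heis c i k w) [RHS]mulrC hformC -[in RHS]hformC E.
  rewrite mulrAC mulrNN -[th ^ _]/(th ^+ k.+1) mulVf ?expf_neq0 // mul1r.
  by apply: congr1; apply: heis_indep.
have -> : - Negz k = k.+1 by lia.
exact: hform_osc_var.
Qed.

End ContravariantForm.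

(** * Adjoint vertex operators on M^l *)

Section AdjointVertexOperator.
Variables (C : numFieldType) (l : nat) (th : C).
Hypothesis th0 : th != 0.
Local Notation osc := (osc l).
Local Notation Ml := (Ml C l).
Local Notation mon := (vmon C l).
Local Notation monom := {cmonom osc}.
Local Notation Cl := 'rV[C]_l.
Local Notation hform := (@hform C l th).
Implicit Types (a b c : Cl) (i : 'I_l) (v u w x y : Ml) (m : monom) (o : osc).

(** Adjunction reverses the order of the factors, which commute. *)
Lemma powcoef_adjoint (A A' : nat -> Ml -> Ml) (r p : nat) v w :
  (forall n x y, (0 < n)%N -> hform (A n x) y = th ^- n * hform x (A' n y)) ->
  (forall n, linear (A' n)) ->
  (forall n k x, (0 < n)%N -> (0 < k)%N -> A' n (A' k x) = A' k (A' n x)) ->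
  hform (powcoef A r p v) w = th ^- p * hform v (powcoef A' r p w).
Proof.
move=> adj lA comm; elim: r p v w => [|r IH] p v w /=.
  have [->|_] := eqVneq p 0%N; first by rewrite expr0 invr1 mul1r.
  by rewrite !mulr0n hform0l hform0r mulr0.
rewrite hform_suml hform_sumr mulr_sumr; apply: eq_big_nat => n /andP[n0 np].
rewrite adj // IH mulrA -invfM -exprD addnC subnK //.
apply: congr1; apply: congr1; apply/esym; apply: powcoef_comm => // k x k0.
exact: comm.
Qed.

Lemma expcoef_adjoint (A A' : nat -> Ml -> Ml) (p : nat) v w :
  (forall n x y, (0 < n)%N -> hform (A n x) y = th ^- n * hform x (A' n y)) ->
  (forall n, linear (A' n)) ->
  (forall n k x, (0 < n)%N -> (0 < k)%N -> A' n (A' k x) = A' k (A' n x)) ->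
  hform (expcoef A p v) w = th ^- p * hform v (expcoef A' p w).
Proof.
move=> adj lA comm; rewrite /expcoef hform_suml hform_sumr mulr_sumr.
apply: eq_bigr => r _; rewrite hformZl hformZr (powcoef_adjoint _ _ _ _ adj) //.
exact: mulrCA.
Qed.

Lemma ymcoef_adjoint b c a (n : nat) v w : (0 < n)%N ->
  hform (ymcoef b a n v) w = th ^- n * hform v (ypcoef c a n w).
Proof.
move=> n0; rewrite /ymcoef /ypcoef /amode hformZl hformZr hform_suml hform_sumr.
rewrite !mulr_sumr; apply: eq_bigr => i _; rewrite hformZl hformZr.
have nN0 : - n%:Z != 0 by lia.
rewrite (hform_heis th0 b c i v w nN0) opprK.
rewrite -exprnN.
by move: (hform v _) (th ^- n) (n%:R^-1) (a 0 i) => X t s z; ring.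
Qed.

Lemma ypcoef_comm c a (n k : nat) v : (0 < n)%N -> (0 < k)%N ->
  ypcoef c a n (ypcoef c a k v) = ypcoef c a k (ypcoef c a n v).
Proof.
move=> n0 k0; rewrite {2 3}/ypcoef (lin_scale (ypcoef_linear c a n)).
congr (_ *: _); apply: amode_comm => [|i x]; first exact: ypcoef_linear.
apply/esym; rewrite /ypcoef (lin_scale (heis_linear c i k%:Z)); congr (_ *: _).
apply: amode_comm => [|j y]; first exact: heis_linear.
rewrite heis_comm; have -> : (k%:Z + n%:Z == 0) = false by lia.
by rewrite andbF mulr0n scale0r addr0.
Qed.

Lemma ym_adjoint b c a (n : nat) v w :
  hform (ym b a n v) w = th ^- n * hform v (yp c a n w).
Proof.
rewrite ym.unlock yp.unlock; apply: expcoef_adjoint => [k x y|k|k j x].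
- exact: ymcoef_adjoint.
- exact: ypcoef_linear.
- exact: ypcoef_comm.
Qed.

Lemma yp_adjoint b c a (n : nat) v w :
  hform (yp b a n v) w = th ^+ n * hform v (ym c a n w).
Proof.
rewrite [hform v _]hformC (ym_adjoint c b) mulrA (mulfV (expf_neq0 n th0)) mul1r.
exact: hformC.
Qed.

Lemma Yop_vacuum b v (p : int) : Yop b 1 v p = v *+ (p == 0).
Proof.
rewrite -vmon1 Yop_mon.
have -> : factors (mone : monom) = [::] by rewrite /factors mdom1.
exact: erefl.
Qed.

(** The adjoint of Y_-(a, z) Y_+(a, z) is again of this form since Y_- and Y_+
    are exchanged. *)
Lemma Ynorm_vacuum_adjoint a b c (p : int) v w :
  hform (Ynorm a 1 b v p) w = th ^ (- p) * hform v (Ynorm a 1 c w (- p)).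
Proof.
have [M1 E1] := Ynorm_window_ex a 1 b v p.
have [M2 E2] := Ynorm_window_ex a 1 c w (- p).
rewrite (E1 _ (leq_addr M2 M1)) (E2 _ (leq_addl M1 M2)).
rewrite /Ynorm_window hform_suml hform_sumr.
under eq_bigr do rewrite hform_suml.
under [in RHS]eq_bigr do rewrite hform_sumr.
rewrite [X in _ * X]exchange_sum mulr_sumr; apply: eq_bigr => n1 _.
rewrite mulr_sumr; apply: eq_bigr => n2 _.
rewrite !Yop_vacuum (ym_adjoint _ c).
have -> : (- p - n2%:Z + n1%:Z == 0) = (p - n1%:Z + n2%:Z == 0) by lia.
case: eqP => [pE|_]; last first.
  by rewrite !mulr0n (lin0 (ym_linear c a n2)) hform0l hform0r !mulr0.
rewrite !mulr1n (yp_adjoint _ c) mulrA; congr (_ * _).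
have -> : - p = n2%:Z - n1%:Z by lia.
by rewrite (expfzDr _ _ th0) mulrC -exprnN.
Qed.

End AdjointVertexOperator.

Section AdjointTheorem.
Variables (C : numFieldType) (l : nat) (th : C).
Hypothesis th0 : th != 0.
Local Notation osc := (osc l).
Local Notation Ml := (Ml C l).
Local Notation mon := (vmon C l).
Local Notation monom := {cmonom osc}.
Local Notation Cl := 'rV[C]_l.
Local Notation hform := (@hform C l th).
Implicit Types (a b c : Cl) (i : 'I_l) (v u w x y : Ml) (m : monom) (o : osc).

(** The mode n of a normally ordered product becomes the mode - n of the adjoint
    product. The mode 0 acts by b^i on M_b and by c^i = - b^i - a^i on M_c, which
    leaves the term in a^i. *)
Lemma mode_adjoint a b c i (n : int) (F G : Ml -> Ml) (kap : C) v w :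
  a + b + c = 0 -> linear F -> linear G ->
  (forall x y, hform (F x) y = - th ^ (- n) * kap * hform x (G y)) ->
  hform (lmode i n (F (rmode b i n v))) w
  = kap * (hform v (lmode i (- n) (G (rmode c i (- n) w)))
           + (n == 0)%:R * (a 0 i * hform v (G w))).
Proof.
move=> abc lF lG adj.
have thn : th ^ n * th ^ (- n) = 1 by rewrite -(expfzDr _ _ th0) subrr.
have [n0|n0|n0] := ltrgt0P n.
- have nN0 : n != 0 by lia.
  rewrite /lmode /rmode oppr_lt0 n0 ltNge (ltW n0) /= mul0r addr0.
  rewrite adj (hform_heis th0 b 0 i v (G w) nN0).
  move: (hform v _) => X; rewrite -[RHS]mul1r -thn; ring.
- have nN0 : n != 0 by lia.
  rewrite /lmode /rmode oppr_lt0 n0 ltNge (ltW n0) /= mul0r addr0.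
  rewrite (hform_heis th0 0 c i (F v) w nN0) adj.
  move: (hform v _) => X; rewrite -[RHS]mul1r -thn; ring.
- rewrite n0 /lmode /rmode oppr0 ltxx !heis_zero mul1r.
  rewrite (lin_scale lF) (lin_scale lG) hformZl hformZr adj n0 oppr0 expr0z.
  have -> : b 0 i = - a 0 i - c 0 i.
    have := congr1 (fun A : Cl => A 0 i) abc; rewrite !mxE => /eqP.
    by rewrite addrAC addr_eq0 => /eqP abcE; rewrite -opprD abcE opprK.
  by move: (hform v _) => X; ring.
Qed.

(** Induction on the number of oscillators of m. By [Ynorm_osc_var] and
    [mode_adjoint], the adjoint for one more oscillator is a sum over the modes
    - n plus a term in a^i; by [Ydiv_osc_var] the right-hand side is a sum over
    the modes n plus a term in a^i, with the same coefficients after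
    n is replaced by - n. *)
Theorem Ynorm_adjoint a b c m (p : int) (R : nat) v w :
  a + b + c = 0 -> (mwt m < R)%N ->
  hform (Ynorm a (mon m) b v p) w
  = (-1) ^+ mwt m * th ^ (- ((mwt m)%:Z + p))
    * hform v (Ydiv a c (mon m) R w (- (mwt m)%:Z *+ 2 - p)).
Proof.
move=> abc; elim/monom_ind: m p v w => [|[i k] m IH] p v w.
  rewrite mwt1 vmon1 => R0; rewrite expr0 mul1r add0r oppr0 mul0rn add0r.
  rewrite (Ynorm_vacuum_adjoint th0 a b c); apply: congr1; apply: congr1.
  case: R R0 => // R _; rewrite Ydiv.unlock big_ord_recl big1 ?addr0.
    by rewrite divpow0 add0r.
  move=> r _; rewrite (divpow_vir1_high a (degle1 C l)); last by [].
  exact: (lin0 (Ynorm_linear_l a c w _)).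
rewrite mwtM mwtU => mR; rewrite -osc_var_mon.
have [d1 dv] := degle_exists v; have [d2 dw] := degle_exists w.
pose K := (d1 + d2 + absz p + (mwt m).*2 + k.+1.*2).+1.
have hm : degle (mwt m)%:Z (mon m) by exact: degle_mon.
have dK : d1%:Z < K%:Z by lia.
have pK : d1%:Z + p + (mwt m)%:Z + k.+1%:Z < K%:Z by lia.
rewrite (Ynorm_osc_var a b (o := (i, k)) dv hm dK pK) /mode_sum /=.
set t := - (k.+1 + mwt m)%N%:Z *+ 2 - p.
have dK' : d2%:Z < K%:Z by lia.
have tK : d2%:Z + t + (mwt m)%:Z + k.+1%:Z < K%:Z by rewrite /t; lia.
have mR' : (mwt m + k.+1 < R)%N by rewrite addnC.
have mR'' : (mwt m < R)%N by lia.
rewrite (Ydiv_osc_var a c i hm dw mR' dK' tK).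
rewrite [X in hform v (X + _)]sum_modes_opp.
rewrite [hform v (_ + _)]hformDr.
rewrite [LHS]hform_suml.
rewrite [X in _ * (X + _)]hform_sumr.
rewrite [X in _ * (_ + X)]hformZr.
(* The factor common to all modes: - th^n times the constant of the induction
   hypothesis at the exponent p + n + k + 1. *)
pose kap : C := - (-1) ^+ mwt m * th ^ (- ((mwt m)%:Z + p + k.+1%:Z)).
pose G n := Ydiv a c (mon m) R ^~ (t - n + k.+1%:Z).
transitivity (\sum_(n <- modes K) (dcoef C k n * kap) *
  (hform v (lmode i (- n) (G n (rmode c i (- n) w)))
   + (n == 0)%:R * (a 0 i * hform v (G n w)))).
  apply: eq_bigr => n _; rewrite hformZl -mulrA; apply: congr1.
  apply: (@mode_adjoint a b c i n
    (fun x => Ynorm a (mon m) b x (p + n + k.+1%:Z)) (G n) kap v w abc).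
  - exact: Ynorm_linear.
  - exact: Ydiv_linear.
  move=> x y; rewrite (IH _ _ _ mR'') /G.
  have -> : - (mwt m)%:Z *+ 2 - (p + n + k.+1%:Z) = t - n + k.+1%:Z.
    by rewrite /t; lia.
  apply: congr2; last exact: erefl.
  have -> : - ((mwt m)%:Z + (p + n + k.+1%:Z))
    = - n - ((mwt m)%:Z + p + k.+1%:Z) by lia.
  by rewrite (expfzDr _ _ th0) /kap mulNr mulrN mulNr opprK mulrCA.
have kapE : (-1) ^+ (k.+1 + mwt m) * th ^ (- ((k.+1 + mwt m)%N%:Z + p))
    = (-1) ^+ k * kap.
  have -> : (k.+1 + mwt m)%N%:Z + p = (mwt m)%:Z + p + k.+1%:Z by lia.
  by rewrite /kap exprD exprS -!mulrA mulN1r !mulNr mulrN.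
rewrite kapE mulrDr mulr_sumr.
under eq_bigr do rewrite mulrDr.
rewrite sum_split; apply: congr2.
  apply: eq_bigr => n _; rewrite hformZr opprK [RHS]mulrA; apply: congr2; last first.
    exact: erefl.
  by rewrite [RHS]mulrACA -exprMn mulrNN mulr1 expr1n mul1r mulrC.
rewrite (sum_modes1 (n0 := 0)) => [|//|n /negbTE ->]; last by rewrite mul0r mulr0.
have -> : dcoef C k 0 = (-1) ^+ k * 'C(0 + k, k)%:R by [].
rewrite eqxx mul1r /G subr0 add0n binn mulr1.
exact: erefl.
Qed.

End AdjointTheorem.

(** * Vertex operators on the direct sum of the M_b *)

Section TotalSpaceSums.
Variables (C : numFieldType) (l : nat).
Local Notation Ml := (Ml C l).
Local Notation mon := (vmon C l).
Local Notation Cl := 'rV[C]_l.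
Local Notation calM := (calM C l).
Local Notation comp := Defs.comp.
Implicit Types (a b c : Cl) (u v w : Ml) (x y : calM).

Lemma comp_tens b u a : comp b (tens u a) = u *+ (a == b).
Proof. by rewrite tens.unlock; exact: mcoeffU. Qed.

Lemma tens_linear a : linear (fun u => tens u a).
Proof.
move=> d u v; apply: calM_ext => b; rewrite compD.
rewrite -[d *: tens u a]/(calM_scale d (tens u a)) comp_scale !comp_tens.
by rewrite mulrnDl scalerMnr.
Qed.

Lemma tens0 a : tens 0 a = 0 :> calM.
Proof. exact: (lin0 (tens_linear a)). Qed.

Lemma sum_supp_tens (V : nmodType) (F : Cl -> Ml -> V) u a :
  (forall b, F b 0 = 0) ->
  \sum_(b <- supp (tens u a)) F b (comp b (tens u a)) = F a u.
Proof.
move=> F0; rewrite tens.unlock /supp /comp.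
have [->|u0] := eqVneq u 0.
  by rewrite big1 ?F0 // => b _; rewrite mcoeffU mul0rn F0.
by rewrite msuppU (negbTE u0) big_seq_fset1 mcoeffUU.
Qed.

Lemma sum_supp_widen (V : nmodType) (F : Cl -> Ml -> V) (d : {fset Cl}) x :
  (forall b, F b 0 = 0) -> (msupp x `<=` d)%fset ->
  \sum_(b <- supp x) F b (comp b x) = \sum_(b <- d) F b (comp b x).
Proof.
move=> F0 xd; apply: big_fset_incl => // b _ bx.
by rewrite /comp mcoeff_outdom.
Qed.

Lemma calM_sum x : x = \sum_(b <- supp x) tens (comp b x) b.
Proof.
apply: calM_ext => b; rewrite (big_morph (comp b) (compD b) (mcoeff0 b)).
under eq_bigr do rewrite comp_tens.
have [bx|bx] := boolP (b \in supp x).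
  rewrite (bigD1_seq b) ?fset_uniq //= eqxx mulr1n big1 ?addr0 // => c /negbTE ->.
  exact: mulr0n.
rewrite big1_seq => [|c /= cx]; first exact: mcoeff_outdom.
by case: eqP => // cb; rewrite -cb cx in bx.
Qed.

End TotalSpaceSums.

Section Intertwiners.
Variables (C : numFieldType) (l : nat).
Local Notation Ml := (Ml C l).
Local Notation mon := (vmon C l).
Local Notation Cl := 'rV[C]_l.
Local Notation calM := (calM C l).
Local Notation comp := Defs.comp.
Implicit Types (a b c : Cl) (u v w : Ml) (x y : calM).
Variable eps : Cl -> Cl -> C.

Lemma eop_tens a u b : eop eps a (tens u b) = eps a b *: tens u (a + b).
Proof.
rewrite /eop /cop (sum_supp_tens (F := fun b v => tens (eps a b *: v) b)).
  rewrite /eshift (sum_supp_tens (F := fun b v => tens v (a + b))).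
    exact: (lin_scale (tens_linear _)).
  by move=> d; exact: tens0.
by move=> d; rewrite scaler0; exact: tens0.
Qed.

Lemma eop0 a : eop eps a 0 = 0.
Proof. by rewrite -(tens0 (0 : Cl)) eop_tens !tens0 scaler0. Qed.

Lemma calYtens_int u a v b (k : C) (p : int) : k = p%:~R + dot a b ->
  calYtens eps u a v b k = eps a b *: tens (Ynorm a u b v p) (a + b).
Proof.
move=> kE; rewrite /calYtens -eop_tens; congr (eop _ _ _).
have -> : [set q : int | q%:~R + dot a b = k]%classic = [set p]%classic.
  apply/seteqP; split=> q /=; last by move=> ->.
  by rewrite kE => /addIr /intr_inj.
exact: fsbig_set1.
Qed.

Lemma calYtens_nonint u a v b (k : C) :
  (forall p : int, k <> p%:~R + dot a b) -> calYtens eps u a v b k = 0.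
Proof.
move=> kN; rewrite /calYtens.
have -> : [set q : int | q%:~R + dot a b = k]%classic = set0.
  by apply/seteqP; split=> q //= /esym /kN.
by rewrite fsbig_set0 eop0.
Qed.

Lemma calYtens_linear_l a v b k : linear (fun u => calYtens eps u a v b k).
Proof.
move=> d x y; have [[p kE]|kN] := pselect (exists p : int, k = p%:~R + dot a b).
  rewrite !(calYtens_int _ _ kE) Ynorm_linear_l tens_linear scalerDr !scalerA.
  by rewrite mulrC.
have kN' p : k <> p%:~R + dot a b by move=> kE; apply: kN; exists p.
by rewrite !calYtens_nonint // scaler0 addr0.
Qed.

Lemma calYtens_shape u a v b k :
  exists z, calYtens eps u a v b k = tens z (a + b).
Proof.
have [[p kE]|kN] := pselect (exists p : int, k = p%:~R + dot a b).
  exists (eps a b *: Ynorm a u b v p).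
  by rewrite (calYtens_int _ _ kE) (lin_scale (tens_linear _)).
exists 0; rewrite tens0; apply: calYtens_nonint => p kE.
by apply: kN; exists p.
Qed.

Lemma calY_tens u a v b k :
  calY eps (tens u a) (tens v b) k = calYtens eps u a v b k.
Proof.
have Y0 c z t : calYtens eps z c 0 t k = 0.
  have [[p kE]|kN] := pselect (exists p : int, k = p%:~R + dot c t).
    rewrite (calYtens_int _ _ kE) (lin0 (Ynorm_linear c z t p)) tens0.
    exact: scaler0.
  by apply: calYtens_nonint => p kE; apply: kN; exists p.
pose F c z := \sum_(t <- supp (tens v b)) calYtens eps z c (comp t (tens v b)) t k.
rewrite /calY (sum_supp_tens (F := F)).
  rewrite /F (sum_supp_tens (F := fun t z => calYtens eps u a z t k)) //.
move=> c; rewrite /F big1 // => t _.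
exact: (lin0 (calYtens_linear_l c _ t k)).
Qed.

Lemma Lop_tens n u a : Lop n (tens u a) = tens (vir a n u) a.
Proof.
rewrite /Lop (sum_supp_tens (F := fun b v => tens (vir b n v) b)) // => b.
by rewrite (lin0 (vir_linear b n)) tens0.
Qed.

Lemma iter_Lop_tens n r u a :
  iter r (Lop n) (tens u a) = tens (iter r (vir a n) u) a.
Proof. by elim: r => [|r IH] //; rewrite !iterS IH Lop_tens. Qed.

Definition wtproj a (h : C) u : Ml :=
  \sum_(m <- msupp u | weight a m == h) u@_m *: mon m.

Lemma L0proj_tens h u a : L0proj h (tens u a) = tens (wtproj a h u) a.
Proof.
pose F b v := \sum_(m <- msupp v | weight b m == h) tens (v@_m *: mon m) b.
rewrite /L0proj (sum_supp_tens (F := F)).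
  by rewrite /F /wtproj (lin_sum (tens_linear a)).
by move=> b; rewrite /F big1 // => m _; rewrite mcoeff0 scale0r tens0.
Qed.

End Intertwiners.

(** * The adjoint vertex operator as a finite sum *)

Section AdjointIntertwiner.
Variables (C : numFieldType) (l : nat).
Local Notation Ml := (Ml C l).
Local Notation mon := (vmon C l).
Local Notation monom := {cmonom (osc l)}.
Local Notation Cl := 'rV[C]_l.
Local Notation calM := (calM C l).
Local Notation comp := Defs.comp.
Implicit Types (a b c : Cl) (u v w : Ml) (x y : calM) (m : monom).
Variables (eps : Cl -> Cl -> C) (lam : C) (lpow epow : C -> C).

Lemma wtproj_degle a g (h : int) u : degle h u -> degle h (wtproj a g u).
Proof.
move=> /degleP hu; apply: degle_sum => m _.
have [mh|hm] := lerP (mwt m)%:Z h; first exact/degleZ/degle_mon.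
by rewrite hu // scale0r; exact: degle0.
Qed.

(** The coefficient of z^j in exp(- z lam^(-2) L(1)) (lam / (e^(i pi N) z))^(2 L(0)) u. *)
Definition adj_vec a u (R : nat) (j : C) : Ml :=
  \sum_(r <- iota 0 R) (- lam ^- 2) ^+ r *:
    divpow (vir a 1) r ((lpow (- (j - r%:R)) * epow (j - r%:R))
                          *: wtproj a (- (j - r%:R) / 2%:R) u).

Lemma adj_arg_tens a u (h R : nat) (j : C) : degle h%:Z u -> (h < R)%N ->
  adj_arg lam lpow epow (tens u a) j = tens (adj_vec a u R j) a.
Proof.
move=> hu hR; rewrite /adj_arg.
have sE q : scaleL0 lpow epow (tens u a) q
    = tens ((lpow (- q) * epow q) *: wtproj a (- q / 2%:R) u) a.
  by rewrite /scaleL0 L0proj_tens (lin_scale (tens_linear a)).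
have tE r : ((- lam ^- 2) ^+ r / r`!%:R) *:
    iter r (Lop 1) (scaleL0 lpow epow (tens u a) (j - r%:R))
  = tens ((- lam ^- 2) ^+ r *: divpow (vir a 1) r
      ((lpow (- (j - r%:R)) * epow (j - r%:R))
        *: wtproj a (- (j - r%:R) / 2%:R) u)) a.
  by rewrite sE iter_Lop_tens -(lin_scale (tens_linear a)) /divpow scalerA.
rewrite (fsum_supp (s := iota 0 R)) ?iota_uniq //.
  rewrite /adj_vec (lin_sum (tens_linear a)); apply: eq_bigr => r _.
  exact: tE.
move=> r; rewrite mem_iota -leqNgt add0n => Rr; rewrite tE.
have hw := degleZ (lpow (- (j - r%:R)) * epow (j - r%:R))
  (wtproj_degle a (- (j - r%:R) / 2%:R) hu).
rewrite (divpow_vir1_high a hw); last by rewrite ltz_nat (leq_trans hR).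
by rewrite scaler0 tens0.
Qed.

(** The scalar with which the field of L(1)^r m / r! enters the coefficient of z^k
    of the adjoint vertex operator of m. *)
Definition adjcoef a m (r : nat) (k : C) : C :=
  let h := 2%:R * weight a m in
  (- lam ^- 2) ^+ r * (lpow h * epow (- h))
  * (lpow (2%:R * (r%:R - h - k)) * epow (- (r%:R - h - k))).

Lemma weight_eqE a m (j : C) (r : nat) :
  (weight a m == - (j - r%:R) / 2%:R) = (j == r%:R - 2%:R * weight a m).
Proof.
move: (weight a m) (r%:R : C) => z t.
by apply/eqP/eqP => ->; field.
Qed.

Lemma sum_single (V : nmodType) (T : eqType) (s : seq T) (P : pred T) (j : T)
    (F : T -> V) : uniq s -> j \in s -> (forall i, P i = (i == j)) ->
  \sum_(i <- s) (if P i then F i else 0) = F j.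
Proof.
move=> us js PE; rewrite (bigD1_seq j) //= PE eqxx big1 ?addr0 // => i ij.
by rewrite PE (negbTE ij).
Qed.

(** The sum over complex exponents j collapses: (..)^(2 L(0)) multiplies m by a
    power of z with exponent - 2 [weight a m], so after L(1)^r only
    j = r - 2 [weight a m] remains. *)
Lemma calYdag_tens a u c w (h R : nat) (k : C) : degle h%:Z u -> (h < R)%N ->
  calYdag eps lam lpow epow (tens u a) (tens w c) k
  = \sum_(r <- iota 0 R) \sum_(m <- msupp u)
      (u@_m * adjcoef a m r k) *:
      calYtens eps (divpow (vir a 1) r (mon m)) a w c
        (r%:R - 2%:R * weight a m - k).
Proof.
move=> hu hR; rewrite /calYdag.
pose T (j : C) (r : nat) m :=
  ((lpow (2%:R * (j - k)) * epow (- (j - k)))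
   * ((- lam ^- 2) ^+ r * ((lpow (- (j - r%:R)) * epow (j - r%:R)) * u@_m)))
  *: calYtens eps (divpow (vir a 1) r (mon m)) a w c (j - k).
pose T' (j : C) : calM := \sum_(r <- iota 0 R) \sum_(m <- msupp u)
  (if weight a m == - (j - r%:R) / 2%:R then T j r m else 0).
have TE j : (lpow (2%:R * (j - k)) * epow (- (j - k))) *:
    calY eps (adj_arg lam lpow epow (tens u a) j) (tens w c) (j - k) = T' j.
  have lY := @calYtens_linear_l C l eps a w c (j - k).
  rewrite (adj_arg_tens a j hu hR) calY_tens /adj_vec (lin_sum lY) scaler_sumr.
  apply: eq_bigr => r _; rewrite (lin_scale lY).
  have lD := divpow_linear (vir_linear a 1) r.
  rewrite (lin_scale lD) (lin_scale lY) /wtproj (lin_sum lD) (lin_sum lY).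
  rewrite !scaler_sumr big_mkcond; apply: eq_bigr => m _; case: ifP => _ //.
  by rewrite (lin_scale lD) (lin_scale lY) !scalerA /T !mulrA.
pose s := undup [seq r%:R - 2%:R * weight a m | r <- iota 0 R, m <- msupp u].
rewrite (fsum_supp (s := s)) ?undup_uniq //; last first.
  move=> j js; rewrite TE /T' big1_seq // => r /andP[_ rR].
  rewrite big1_seq // => m /andP[_ mu]; rewrite weight_eqE; case: eqP => // jE.
  case/negP: js; rewrite mem_undup jE.
  exact: (allpairs_f (fun r m => r%:R - 2%:R * weight a m) rR mu).
under eq_bigr do rewrite TE /T'.
rewrite exchange_sum; apply: eq_big_seq => r rR.
rewrite exchange_sum; apply: eq_big_seq => m mu.
rewrite (sum_single (j := r%:R - 2%:R * weight a m) (fun j => T j r m)).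
- rewrite /T /adjcoef; congr (_ *: _).
  have -> : - (r%:R - 2%:R * weight a m - r%:R) = 2%:R * weight a m.
    by move: (weight a m) => z; ring.
  have -> : r%:R - 2%:R * weight a m - r%:R = - (2%:R * weight a m).
    by move: (weight a m) => z; ring.
  move: (lpow _) (epow _) (lpow _) (epow _) (u@_m) ((- lam ^- 2) ^+ r).
  by move=> t1 t2 t3 t4 t5 t6; ring.
- exact: undup_uniq.
- rewrite mem_undup.
  exact: (allpairs_f (fun r m => r%:R - 2%:R * weight a m) rR mu).
- by move=> j; exact: weight_eqE.
Qed.

End AdjointIntertwiner.

(** * The invariant form *)

Section Dot.
Variables (C : numFieldType) (l : nat).
Implicit Types a b c : 'rV[C]_l.

Lemma dotC a b : dot a b = dot b a.
Proof. by apply: eq_bigr => i _; rewrite mulrC. Qed.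

Lemma dotDr a b c : dot a (b + c) = dot a b + dot a c.
Proof. by rewrite -big_split; apply: eq_bigr => i _; rewrite mxE mulrDr. Qed.

Lemma dotDl a b c : dot (a + b) c = dot a c + dot b c.
Proof. by rewrite ![dot _ c]dotC dotDr. Qed.

Lemma dotNr a b : dot a (- b) = - dot a b.
Proof. by rewrite /dot -sumrN; apply: eq_bigr => i _; rewrite mxE mulrN. Qed.

Lemma dotNN a b : dot (- a) (- b) = dot a b.
Proof. by rewrite dotNr dotC dotNr opprK dotC. Qed.

Lemma dot0r a : dot a 0 = 0.
Proof. by rewrite /dot big1 // => i _; rewrite mxE mulr0. Qed.

End Dot.

Section CocycleIdentity.
Variables (C : numFieldType) (l : nat).
Local Notation Cl := 'rV[C]_l.
Local Notation calM := (calM C l).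
Local Notation comp := Defs.comp.
Variables (eps : Cl -> Cl -> C).
Hypothesis heps : cocycle_structure eps.
Implicit Types a b c : Cl.

Lemma eps_neq0 a b : eps a b != 0.
Proof. by case: heps. Qed.

Lemma eps0r a : eps a 0 = 1.
Proof. by case: heps => _ /(_ a)[]. Qed.

Lemma eps0l a : eps 0 a = 1.
Proof. by case: heps => _ /(_ a)[]. Qed.

Lemma coef_tens1 (d e : C) t :
  (comp t (d *: tens (e *: 1) t : calM))@_mone = d * e.
Proof.
rewrite -[d *: tens _ _]/(calM_scale d (tens (e *: 1) t)) comp_scale comp_tens.
by rewrite eqxx mulr1n !mcoeffZ mcoeff1 eqxx mulr1.
Qed.

Lemma cocycle a b c :
  eps b c * eps a (b + c) = eps a b * eps (a + b) c.
Proof.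
case: heps => _ _ /(_ a b (tens 1 c)) E _.
have L : eop eps a (eop eps b (tens 1 c))
    = eps a (b + c) *: tens (eps b c *: 1) (a + b + c).
  by rewrite (eop_tens eps b) -(lin_scale (tens_linear _)) eop_tens addrA.
have Rt : eps a b *: eop eps (a + b) (tens 1 c)
    = eps a b *: tens (eps (a + b) c *: 1) (a + b + c).
  apply: congr1; rewrite eop_tens; apply: esym.
  exact: (lin_scale (tens_linear _)).
have := congr1 (fun x : calM => (comp (a + b + c) x)@_mone)
  (etrans (esym L) (etrans E Rt)).
move=> E'; rewrite mulrC.
exact: etrans (esym (coef_tens1 _ _ _)) (etrans E' (coef_tens1 _ _ _)).
Qed.

Lemma eps_opp b : eps b (- b) = eps (- b) b.
Proof.
by have := cocycle b (- b) b; rewrite addNr subrr eps0r eps0l !mulr1.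
Qed.

End CocycleIdentity.

Section InvariantForm.
Variables (C : numFieldType) (l : nat).
Local Notation Ml := (Ml C l).
Local Notation mon := (vmon C l).
Local Notation monom := {cmonom (osc l)}.
Local Notation Cl := 'rV[C]_l.
Local Notation calM := (calM C l).
Local Notation comp := Defs.comp.
Variables (eps : Cl -> Cl -> C) (lam : C) (lpow epow : C -> C).
Hypothesis heps : cocycle_structure eps.
Hypothesis lam0 : lam != 0.
Hypothesis lpowD : forall s t, lpow (s + t) = lpow s * lpow t.
Hypothesis lpow_int : forall n : int, lpow n%:~R = lam ^ n.
Hypothesis epowD : forall s t, epow (s + t) = epow s * epow t.
Hypothesis epow_int : forall n : int, epow n%:~R = (-1) ^ n.
Implicit Types (a b c : Cl) (u v w : Ml) (x y : calM) (m : monom).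

Let th : C := - lam ^+ 2.

Lemma th_neq0 : th != 0.
Proof. by rewrite oppr_eq0 expf_neq0. Qed.

Lemma lam_pow2 (n : int) : lam ^ (n *+ 2) = (-1) ^ n * th ^ n.
Proof.
by rewrite -expfzMl mulN1r opprK exprnP exprz_exp -mulr_natl.
Qed.

(** The powers of lam and e^(i pi N) in the invariance identity for
    M_a, M_b and M_(-a-b), at the exponent k = p + a.b, against the constant of
    [Ynorm_adjoint]: the non-integral parts of the exponents of e^(i pi N)
    cancel, and those of lam add up to - (a + b)^2. *)
Lemma adjcoefE a b m (r : nat) (p : int) :
  epow (- dot a b) * adjcoef lam lpow epow a m r (p%:~R + dot a b)
    * lpow (- dot b b)
  = lpow (- dot (a + b) (a + b)) * ((-1) ^+ mwt m * th ^ (- ((mwt m)%:Z + p))).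
Proof.
set s := mwt m; pose h := dot a a + 2%:R * s%:R.
have hE : 2%:R * weight a m = h.
  by rewrite /weight -/(mwt m) mulrDr mulrA divff ?pnatr_eq0 // mul1r.
rewrite /adjcoef hE; set k := p%:~R + dot a b.
have eE : epow (- dot a b) * epow (- h) * epow (- (r%:R - h - k))
    = (-1) ^ (p - r%:Z).
  rewrite -!epowD -epow_int; congr epow; rewrite rmorphB /= /k.
  by move: (dot a b) (h) (p%:~R : C) => z t q; rewrite -pmulrn; ring.
have lE : lpow h * lpow (2%:R * (r%:R - h - k)) * lpow (- dot b b)
    = lpow (- dot (a + b) (a + b)) * lam ^ ((r%:Z - s%:Z - p) *+ 2).
  rewrite -!lpowD -lpow_int -lpowD; congr lpow.
  rewrite dotDr !dotDl [dot b a]dotC rmorphMn /= !rmorphB /= -!pmulrn /k /h.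
  move: (dot a b) (dot a a) (dot b b) (p%:~R : C) (r%:R : C) (s%:R : C).
  by move=> t1 t2 t3 t4 t5 t6; ring.
have thE : (- lam ^- 2) ^+ r * lam ^ ((r%:Z - s%:Z - p) *+ 2) * (-1) ^ (p - r%:Z)
    = (-1) ^+ s * th ^ (- (s%:Z + p)).
  have -> : (- lam ^- 2) ^+ r = th ^ (- r%:Z).
    by rewrite -exprnN -exprVn /th invrN.
  have m10 : -1 != 0 :> C by rewrite oppr_eq0 oner_neq0.
  rewrite lam_pow2 mulrCA mulrAC -(expfzDr _ _ th_neq0) -(expfzDr _ _ m10).
  have -> : r%:Z - s%:Z - p + (p - r%:Z) = - s%:Z by lia.
  have -> : - r%:Z + (r%:Z - s%:Z - p) = - (s%:Z + p) by lia.
  by rewrite -exprnN -exprVn invrN1.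
rewrite -thE; transitivity ((- lam ^- 2) ^+ r
  * (lpow h * lpow (2%:R * (r%:R - h - k)) * lpow (- dot b b))
  * (epow (- dot a b) * epow (- h) * epow (- (r%:R - h - k)))).
  move: (lpow _) (epow _) (lpow _) (epow _) (lpow _) (epow _) ((- lam ^- 2) ^+ r).
  by move=> t1 t2 t3 t4 t5 t6 t7; ring.
rewrite lE eE.
move: (lpow _) (lam ^ _) ((-1) ^ _) ((- lam ^- 2) ^+ r) => t1 t2 t3 t4.
ring.
Qed.

(** The value of the invariant form on the pair e^b, e^(-b). *)
Definition charge_norm b : C := eps b (- b) * lpow (- dot b b).

Lemma charge_norm_neq0 b : charge_norm b != 0.
Proof.
rewrite mulf_neq0 ?eps_neq0 //; apply/eqP => l0.
have := lpow_int 0; rewrite expr0z -[0%:~R](addNr (dot b b)) lpowD l0 mul0r.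
by move/eqP; rewrite eq_sym oner_eq0.
Qed.

Lemma charge_norm_opp b : charge_norm (- b) = charge_norm b.
Proof. by rewrite /charge_norm opprK dotNN eps_opp. Qed.

Definition Bform x y : C :=
  \sum_(b <- supp x) charge_norm b * hform th (comp b x) (comp (- b) y).

Lemma Bform_tensl v b y :
  Bform (tens v b) y = charge_norm b * hform th v (comp (- b) y).
Proof.
rewrite /Bform (sum_supp_tens
  (F := fun b v => charge_norm b * hform th v (comp (- b) y))) // => d.
by rewrite hform0l mulr0.
Qed.

Lemma Bform_tens v b w c :
  Bform (tens v b) (tens w c)
  = charge_norm b * (b + c == 0)%:R * hform th v w.
Proof.
rewrite Bform_tensl comp_tens -mulrA; congr (_ * _).
rewrite addrC addr_eq0; case: eqP => _; first by rewrite mul1r mulr1n.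
by rewrite mulr0n hform0r mul0r.
Qed.

Lemma BformPr d x y z : Bform x (d *: y + z) = d * Bform x y + Bform x z.
Proof.
rewrite /Bform mulr_sumr -big_split; apply: eq_bigr => b _ /=.
rewrite compD -[d *: y]/(calM_scale d y) comp_scale hformPr.
by rewrite mulrDr mulrCA.
Qed.

Lemma BformPl d x y z : Bform (d *: y + z) x = d * Bform y x + Bform z x.
Proof.
pose D := (msupp (d *: y + z) `|` (msupp y `|` msupp z))%fset.
pose F b v := charge_norm b * hform th v (comp (- b) x).
have F0 b : F b 0 = 0 by rewrite /F hform0l mulr0.
have D1 : (msupp (d *: y + z) `<=` D)%fset by exact: fsubsetUl.
have D2 : (msupp y `<=` D)%fset.
  exact: fsubset_trans (fsubsetUl _ _) (fsubsetUr _ _).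
have D3 : (msupp z `<=` D)%fset.
  exact: fsubset_trans (fsubsetUr _ _) (fsubsetUr _ _).
have FE t : Bform t x = \sum_(b <- supp t) F b (comp b t) by [].
rewrite !FE (sum_supp_widen F0 D1) (sum_supp_widen F0 D2) (sum_supp_widen F0 D3).
rewrite mulr_sumr -big_split; apply: eq_bigr => b _ /=.
rewrite /F compD -[d *: y]/(calM_scale d y) comp_scale hformPl.
by rewrite mulrDr mulrCA.
Qed.

Lemma Bform0r x : Bform x 0 = 0.
Proof.
by rewrite /Bform big1 // => b _; rewrite /comp mcoeff0 hform0r mulr0.
Qed.

Lemma BformZr d x y : Bform x (d *: y) = d * Bform x y.
Proof. by rewrite -[d *: y]addr0 BformPr Bform0r addr0. Qed.

Lemma Bform_sumr x (I : Type) (r : seq I) (F : I -> calM) :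
  Bform x (\sum_(i <- r) F i) = \sum_(i <- r) Bform x (F i).
Proof.
apply: (big_morph (Bform x)); last exact: Bform0r.
by move=> y z; rewrite -[y]scale1r BformPr scale1r mul1r.
Qed.

Lemma BformZ_tensl d v b y : Bform (d *: tens v b) y = d * Bform (tens v b) y.
Proof.
by rewrite -(lin_scale (tens_linear b)) !Bform_tensl hformZl mulrCA.
Qed.

(** Unless a + b + c = 0 both sides vanish, and unless k lies in a.b + Z neither
    side has a term in z^k. Otherwise the two sides agree, for each monomial of u
    and each power of L(1), by [Ynorm_adjoint], [adjcoefE] and the cocycle
    identity for (b, a, c). *)
Theorem Bform_invariant : invariant_form eps lam lpow epow Bform.
Proof.
move=> u a v b w c k; rewrite calY_tens.
have [h hu] := degle_exists u.
rewrite (calYdag_tens eps lam lpow epow a c w k hu (ltnSn h)) Bform_sumr.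
under eq_bigr do rewrite Bform_sumr.
have [abc|abc] := eqVneq (a + b + c) 0; last first.
  have [z ->] := calYtens_shape eps u a v b k.
  rewrite Bform_tens (negbTE abc) mulr0 mul0r big1 ?mulr0 // => r _.
  rewrite big1 // => m _; rewrite BformZr.
  have [z' ->] := calYtens_shape eps (divpow (vir a 1) r (mon m)) a w c
    (r%:R - 2%:R * weight a m - k).
  by rewrite Bform_tens addrCA addrA (negbTE abc) mulr0 mul0r mulr0.
have cE : c = - (a + b) by apply/eqP; rewrite -addr_eq0 addrC abc.
have acE : dot a c = - dot a a - dot a b by rewrite cE dotNr dotDr opprD.
have expE m (r : nat) : r%:R - 2%:R * weight a m - k
    = (r%:Z - (mwt m)%:Z *+ 2)%:~R - k + dot a c + dot a b.
  rewrite acE rmorphB rmorphMn /= -!pmulrn /weight -/(mwt m).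
  by move: (dot a a) (dot a b) ((mwt m)%:R : C) => z t q; field.
have [[p kE]|kN] := pselect (exists p : int, k = p%:~R + dot a b); last first.
  rewrite calYtens_nonint; last by move=> p kE; apply: kN; exists p.
  rewrite -(tens0 b) Bform_tensl hform0l mulr0 big1 ?mulr0 // => r _.
  rewrite big1 // => m _; rewrite calYtens_nonint ?scaler0 ?Bform0r // => p.
  rewrite expE => E; apply: kN; exists (r%:Z - (mwt m)%:Z *+ 2 - p).
  rewrite rmorphB; move/eqP: E; rewrite -subr_eq0 => /eqP E; apply/eqP.
  rewrite -subr_eq0; apply/eqP; rewrite -[RHS]oppr0 -E; ring.
have bac : b + (a + c) = 0 by rewrite addrCA addrA.
pose K m : C := (-1) ^+ mwt m * th ^ (- ((mwt m)%:Z + p)).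
pose X m (r : nat) : C := hform th v
  (Ynorm a (divpow (vir a 1) r (mon m)) c w (r%:Z + (- (mwt m)%:Z *+ 2 - p))).
have LE : hform th (Ynorm a u b v p) w
    = \sum_(r <- iota 0 h.+1) \sum_(m <- msupp u) u@_m * (K m * X m r).
  rewrite [LHS](_ : _ = \sum_(m <- msupp u)
      u@_m * hform th (Ynorm a (mon m) b v p) w).
    rewrite exchange_sum; apply: eq_big_seq => m mu; rewrite -mulr_sumr.
    have mh : (mwt m < h.+1)%N by have /allP/(_ m mu) := hu.
    rewrite (Ynorm_adjoint th_neq0 p v w abc mh) -mulr_sumr Ydiv.unlock hform_sumr.
    by rewrite -(big_mkord xpredT (X m)) /index_iota subn0.
  rewrite [X in Ynorm a X](vmon_sum u) (lin_sum (Ynorm_linear_l a b v p)).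
  rewrite hform_suml; apply: eq_bigr => m _.
  by rewrite (lin_scale (Ynorm_linear_l a b v p)) hformZl.
rewrite (calYtens_int eps u v kE) BformZ_tensl Bform_tens abc eqxx mulr1 LE.
rewrite !mulr_sumr; apply: eq_bigr => r _.
rewrite !mulr_sumr; apply: eq_bigr => m _.
have E : r%:R - 2%:R * weight a m - k
    = (r%:Z + (- (mwt m)%:Z *+ 2 - p))%:~R + dot a c.
  rewrite expE kE !rmorphD !rmorphN !rmorphMn /=.
  by move: (dot a b) (dot a c) => t1 t2; ring.
rewrite (calYtens_int eps _ w E) scalerA BformZr Bform_tens bac eqxx mulr1.
rewrite -/(X m r) kE.
have epsE : eps a c * eps b (- b) = eps b a * eps (a + b) c.
  rewrite [a + b]addrC -(cocycle heps); congr (_ * eps _ _).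
  by apply/esym/eqP; rewrite -addr_eq0 addrC bac.
have ba0 := eps_neq0 heps b a.
rewrite /charge_norm -cE /commutator.
have -> : epow (- dot a b) * (eps a b / eps b a) *
    (u@_m * adjcoef lam lpow epow a m r (p%:~R + dot a b) * eps a c *
     (eps b (- b) * lpow (- dot b b) * X m r))
  = eps a b / eps b a * (eps a c * eps b (- b)) * (u@_m * X m r)
    * (epow (- dot a b) * adjcoef lam lpow epow a m r (p%:~R + dot a b)
       * lpow (- dot b b)).
  move: (X m r) (epow _) (adjcoef _ _ _ _ _ _ _) (lpow _) => t1 t2 t3 t4.
  move: (eps a b / _) => t5.
  by move: (u@_m) (eps a c) (eps b _) => t6 t7 t8; ring.
rewrite adjcoefE epsE [eps a b / _ * (_ * _)]mulrA (divfK ba0) -/(K m).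
move: (X m r) (K m) (lpow _) (u@_m) (eps a b) (eps _ c) => t1 t2 t3 t4 t5 t6.
ring.
Qed.

End InvariantForm.

(** * Uniqueness *)

Section Uniqueness.
Variables (C : numFieldType) (l : nat).
Local Notation Ml := (Ml C l).
Local Notation mon := (vmon C l).
Local Notation monom := {cmonom (osc l)}.
Local Notation Cl := 'rV[C]_l.
Local Notation calM := (calM C l).
Local Notation comp := Defs.comp.
Variables (eps : Cl -> Cl -> C) (lam : C) (lpow epow : C -> C).
Hypothesis heps : cocycle_structure eps.
Hypothesis lam0 : lam != 0.
Hypothesis lpowD : forall s t, lpow (s + t) = lpow s * lpow t.
Hypothesis lpow_int : forall n : int, lpow n%:~R = lam ^ n.
Hypothesis epowD : forall s t, epow (s + t) = epow s * epow t.
Hypothesis epow_int : forall n : int, epow n%:~R = (-1) ^ n.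
Implicit Types (a b c : Cl) (u v w : Ml) (x y : calM) (m : monom).

Local Notation th := (- lam ^+ 2).
Local Notation charge_norm := (charge_norm eps lpow).
Local Notation Bform := (Bform eps lam lpow).

Lemma lpow0 : lpow 0 = 1.
Proof. by have := lpow_int 0; rewrite expr0z. Qed.

Lemma epow0 : epow 0 = 1.
Proof. by have := epow_int 0; rewrite expr0z. Qed.

Lemma amode0_charge b (n : int) v : amode b 0 n v = 0.
Proof. by rewrite /amode big1 // => i _; rewrite mxE scale0r. Qed.

Lemma ym0_charge b n v : ym b 0 n v = v *+ (n == 0%N).
Proof.
rewrite ym.unlock; apply: expcoef_zero => k w.
by rewrite /ymcoef amode0_charge scaler0.
Qed.

Lemma yp0_charge b n v : yp b 0 n v = v *+ (n == 0%N).
Proof.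
rewrite yp.unlock; apply: expcoef_zero => k w.
by rewrite /ypcoef amode0_charge scaler0.
Qed.

Lemma Ynorm0_charge u b v (p : int) : Ynorm 0 u b v p = Yop b u v p.
Proof.
have [M0 EM] := Ynorm_window_ex 0 u b v p; rewrite (EM M0.+1) ?leqnSn //.
rewrite /Ynorm_window.
transitivity (\sum_(n1 <- iota 0 M0.+1) (if n1 == 0%N then Yop b u v p else 0)).
  apply: eq_bigr => n1 _.
  transitivity (\sum_(n2 <- iota 0 M0.+1)
    (if n2 == 0%N then Yop b u v (p - n1%:Z) *+ (n1 == 0%N) else 0)).
    apply: eq_bigr => n2 _; rewrite ym0_charge yp0_charge.
    have [->|n2N] := eqVneq n2 0%N; first by rewrite mulr1n addr0.
    by rewrite mulr0n (lin0 (Yop_linear b u _)) mul0rn.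
  rewrite (sum_single (j := 0%N)) ?iota_uniq ?mem_iota //.
  by case: eqP => [->|_]; [rewrite subr0 mulr1n | rewrite mulr0n].
by rewrite (sum_single (j := 0%N)) ?iota_uniq ?mem_iota.
Qed.

Lemma Yop_generator b i v (p : int) :
  Yop b (osc_var C (i, 0%N)) v p = heis b i (- (p + 1)) v.
Proof.
rewrite /osc_var Yop_mon (Yseq_perm b (s' := [:: (i, 0%N)])) ?Yseq1 //.
by apply: perm_factors => o; rewrite /= cmU addn0.
Qed.

Lemma Ynorm_vacuum b c : Ynorm b 1 c 1 0 = 1.
Proof.
have d1 := degle1 C l.
rewrite (Ynorm_windowE (M := 1) b c d1 d1) // /Ynorm_window /= !big_seq1.
rewrite Yop_vacuum eqxx mulr1n.
have e0 A (v : Ml) : expcoef A 0 v = v.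
  by rewrite /expcoef big_ord_recl big_ord0 addr0 /= invr1 scale1r.
by rewrite ym.unlock yp.unlock !e0.
Qed.

Lemma calYdag_primary a m w c (k : C) :
  (forall r, (0 < r)%N -> divpow (vir a 1) r (mon m) = 0) ->
  calYdag eps lam lpow epow (tens (mon m) a) (tens w c) k
  = adjcoef lam lpow epow a m 0 k *:
    calYtens eps (mon m) a w c (- (2%:R * weight a m) - k).
Proof.
move=> prim; have hm : degle (mwt m)%:Z (mon m) by exact: degle_mon.
rewrite (calYdag_tens eps lam lpow epow a c w k hm (ltnSn _)).
transitivity (\sum_(r <- iota 0 (mwt m).+1)
  (if r == 0%N then adjcoef lam lpow epow a m 0 k *:
    calYtens eps (mon m) a w c (- (2%:R * weight a m) - k) else 0)); last first.
  by rewrite (sum_single (j := 0%N)) ?iota_uniq ?mem_iota.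
apply: eq_bigr => r _.
have -> : msupp (mon m) = [fset m]%fset by rewrite vmon.unlock msuppU1.
rewrite big_seq_fset1 mcoeff_vmon eqxx mul1r.
have [->|r0] := posnP r; first by rewrite divpow0 sub0r.
rewrite prim // (lin0 (calYtens_linear_l eps _ _ _ _)) scaler0.
exact: erefl.
Qed.

(** On M_0 the vector L(1) a^i(-1) 1 = a^i(0) 1 vanishes. *)
Lemma generator_primary i r : (0 < r)%N ->
  divpow (vir (0 : Cl) 1) r (mon (ucm (i, 0%N))) = 0.
Proof.
move=> r0; rewrite -[mon _]/(osc_var C (i, 0%N)) -[osc_var _ _]mulr1.
rewrite (osc_var_heis 0) divpow_vir1_heis big1 // => j _.
have [jr|rj] := ltnP j r.
  rewrite (divpow_vir1_high _ (degle1 C l)) ?heis0 ?scaler0 //.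
  by rewrite ltz_nat subn_gt0.
have -> : j = r :> nat by apply/eqP; rewrite eqn_leq rj -ltnS ltn_ord.
case: r r0 {j rj} => [//|[|r]] _.
  by rewrite subrr heis_zero mxE scale0r scaler0.
by rewrite bin_small // scale0r.
Qed.

Lemma vacuum_primary a r : (0 < r)%N -> divpow (vir a 1) r (mon mone) = 0.
Proof.
by move=> r0; rewrite vmon1 (divpow_vir1_high _ (degle1 C l)).
Qed.

Variable B : calM -> calM -> C.
Hypothesis BPl : forall d x y z, B (d *: x + y) z = d * B x z + B y z.
Hypothesis BPr : forall d x y z, B z (d *: x + y) = d * B z x + B z y.
Hypothesis Binv : invariant_form eps lam lpow epow B.
Hypothesis B1 : B (tens 1 0) (tens 1 0) = 1.

Lemma tensZ d v b : tens (d *: v) b = d *: tens v b :> calM.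
Proof. exact: (lin_scale (tens_linear b)). Qed.

Lemma inv0r x : B x 0 = 0.
Proof.
have E := BPr 1 0 0 x; move: E; rewrite scale1r addr0 mul1r => E.
by apply: (addrI (B x 0)); rewrite -E addr0.
Qed.

Lemma inv0l x : B 0 x = 0.
Proof.
have E := BPl 1 0 0 x; move: E; rewrite scale1r addr0 mul1r => E.
by apply: (addrI (B 0 x)); rewrite -E addr0.
Qed.

Lemma invZr d x y : B x (d *: y) = d * B x y.
Proof. by rewrite -[d *: y]addr0 BPr inv0r addr0. Qed.

Lemma invZl d x y : B (d *: x) y = d * B x y.
Proof. by rewrite -[d *: x]addr0 BPl inv0l addr0. Qed.

(** Invariance for a primary vector, where the exponential of L(1) drops out. *)
Lemma inv_primary a m v b w c (k : C) :
  (forall r, (0 < r)%N -> divpow (vir a 1) r (mon m) = 0) ->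
  B (calYtens eps (mon m) a v b k) (tens w c)
  = epow (- dot a b) * commutator eps a b * adjcoef lam lpow epow a m 0 k
    * B (tens v b) (calYtens eps (mon m) a w c (- (2%:R * weight a m) - k)).
Proof.
move=> prim; have := Binv (mon m) a v b w c k.
by rewrite calY_tens (calYdag_primary _ _ _ prim) invZr mulrA.
Qed.

Lemma adjcoef_primary a b m (p : int) :
  adjcoef lam lpow epow a m 0 (p%:~R + dot a b)
  = lpow (dot b b - dot (a + b) (a + b)) * epow (dot a b)
    * ((-1) ^+ mwt m * th ^ (- ((mwt m)%:Z + p))).
Proof.
have E := adjcoefE lam0 lpowD lpow_int epowD epow_int a b m 0 p.
transitivity (epow (dot a b) * lpow (dot b b) *
  (epow (- dot a b) * adjcoef lam lpow epow a m 0 (p%:~R + dot a b)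
    * lpow (- dot b b))); last first.
  rewrite E lpowD.
  move: (epow _) (lpow _) (lpow _) (_ ^+ mwt m) (_ ^ _) => t1 t2 t3 t4 t5; ring.
transitivity ((epow (dot a b) * epow (- dot a b)) * (lpow (dot b b) * lpow (- dot b b))
   * adjcoef lam lpow epow a m 0 (p%:~R + dot a b)).
  by rewrite -epowD -lpowD !subrr epow0 lpow0 !mul1r.
move: (epow _) (epow _) (lpow _) (lpow _) (adjcoef _ _ _ _ _ _ _) => t1 t2 t3 t4 t5.
ring.
Qed.

(** Invariance for u = a^i(-1) 1 and a = 0, whose field is sum_n a^i(n) z^(-n-1). *)
Lemma inv_heis i (n : int) v b w c :
  B (tens (heis b i n v) b) (tens w c)
  = - th ^ n * B (tens v b) (tens (heis c i (- n) w) c).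
Proof.
pose p : int := - (n + 1); pose k : C := p%:~R + dot 0 b.
have d0 t : dot 0 t = 0 by rewrite dotC dot0r.
have := inv_primary v b w c k (generator_primary i).
rewrite (calYtens_int eps _ v (p := p)) // Ynorm0_charge Yop_generator.
have wE : weight 0 (ucm (i, 0%N)) = 1 :> C.
  by rewrite /weight d0 mulr0 add0r -/(mwt _) mwtU.
have kE : - (2%:R * weight 0 (ucm (i, 0%N))) - k = (n - 1)%:~R + dot 0 c.
  by rewrite wE /k !d0 /p !addr0 rmorphN rmorphD rmorphB /=; ring.
rewrite (calYtens_int eps _ w kE) Ynorm0_charge Yop_generator.
rewrite adjcoef_primary !add0r d0 oppr0 epow0 subrr lpow0 mwtU.
rewrite /commutator (eps0l heps) (eps0r heps) !(eps0l heps) divr1 !mul1r !scale1r.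
have -> : - (p + 1) = n by rewrite /p; lia.
have -> : - (n - 1 + 1) = - n by lia.
have -> : - (1%N%:Z + p) = n by rewrite /p; lia.
by rewrite expr1 mulN1r.
Qed.

(** Invariance for u = v = w = 1 and the charges b, 0, - b: the constant term of
    the vertex operator of e^b carries 1 to a multiple of e^b, and e^(-b) to a
    multiple of 1. *)
Lemma inv_charge b : B (tens 1 b) (tens 1 (- b)) = charge_norm b.
Proof.
have k0 : (0 : C) = (0 : int)%:~R + dot b 0 by rewrite dot0r addr0.
have := inv_primary 1 0 1 (- b) 0 (vacuum_primary b).
rewrite (calYtens_int eps _ 1 k0) vmon1 Ynorm_vacuum (eps0r heps) scale1r addr0.
move=> ->.
have wE : - (2%:R * weight b mone) - 0 = (0 : int)%:~R + dot b (- b).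
  rewrite /weight -/(mwt _) mwt1 dotNr !addr0 subr0 add0r mulrA.
  by rewrite divff ?pnatr_eq0 // mul1r.
rewrite (calYtens_int eps _ 1 wE) Ynorm_vacuum subrr invZr B1 mulr1.
rewrite {1}k0 adjcoef_primary !dot0r mwt1 oppr0 epow0 /commutator (eps0r heps).
rewrite (eps0l heps) divr1 !addr0 sub0r oppr0 expr0z expr0 !mul1r !mulr1.
by rewrite mulrC.
Qed.

(** By [inv_heis] at n = 0 the form vanishes unless b + c = 0; oscillators of v
    move to the other side as annihilation operators, after which oscillators of
    w move back and annihilate 1, and [inv_charge] evaluates what is left. *)
Lemma inv_tens v b w c :
  B (tens v b) (tens w c) = charge_norm b * (b + c == 0)%:R * hform th v w.
Proof.
have [bc|bc] := eqVneq (b + c) 0; last first.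
  have [i ic] : exists i, b 0 i + c 0 i != 0.
    apply/existsP; apply: contraR bc; rewrite negb_exists => /forallP bc0.
    apply/eqP/rowP => i; rewrite !mxE; apply/eqP.
    by have := bc0 i; rewrite negbK.
  have E1 : B (tens (heis b i 0 v) b) (tens w c)
      = b 0 i * B (tens v b) (tens w c) by rewrite heis_zero tensZ invZl.
  have E2 : B (tens v b) (tens (heis c i (- 0) w) c)
      = c 0 i * B (tens v b) (tens w c).
    by rewrite oppr0 heis_zero tensZ invZr.
  rewrite mulr0 mul0r.
  have := etrans (esym E1) (etrans (inv_heis i 0 v b w c) (congr1 _ E2)).
  rewrite expr0z mulN1r => /eqP.
  by rewrite -addr_eq0 -mulrDl mulf_eq0 (negbTE ic) => /eqP.
have -> : c = - b by apply/eqP; rewrite -addr_eq0 addrC bc.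
rewrite mulr1; move: v; apply: hform_ext => [d x y|d x y|m].
- by rewrite tens_linear BPl.
- by rewrite hformPl mulrDr mulrCA.
elim/monom_ind: m w => [|[i k] m IH] w.
  move: w; apply: hform_ext => [d x y|d x y|m].
  - by rewrite tens_linear BPr.
  - by rewrite hformPr mulrDr mulrCA.
  elim/monom_ind: m => [|[i k] m _].
    by rewrite vmon1 inv_charge hform1 mulr1.
  rewrite hform_mon cmM_eq1 cm1_eq1 mul0r mulr0.
  have := inv_heis i k.+1 (mon mone) b (mon m) (- b).
  rewrite heis_posU cm1 muln0 scale0r tens0 inv0l -(osc_var_heis (- b)).
  rewrite osc_var_mon => /esym/eqP; rewrite mulf_eq0 oppr_eq0.
  by rewrite (negbTE (expfz_neq0 _ (th_neq0 lam0))) => /eqP.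
rewrite -osc_var_mon hform_osc_var mulrCA -[charge_norm b * _]IH.
rewrite (osc_var_heis b) inv_heis opprK.
apply: congr2; first by rewrite -exprnN.
by apply: congr1; apply: congr2; [apply: heis_indep | exact: erefl].
Qed.

End Uniqueness.

(** * Complex powers and the theorem *)

Lemma biscalarPl (F : nzRingType) (U : lmodType F) (f : {biscalar U}) d x y z :
  f (d *: x + y) z = d * f x z + f y z.
Proof. by rewrite linearPl. Qed.

Lemma biscalarPr (F : nzRingType) (U : lmodType F) (f : {biscalar U}) d x y z :
  f z (d *: x + y) = d * f z x + f z y.
Proof. by rewrite linearPr. Qed.

Section BilinearInstance.
Variables (C : numFieldType) (l : nat).
Local Notation calM := (calM C l).
Local Notation comp := Defs.comp.
Variables (eps : 'rV[C]_l -> 'rV[C]_l -> C) (lam : C) (lpow : C -> C).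

Lemma Bform_bilinear : bilinear_for *%R *%R (Bform eps lam lpow).
Proof. by split=> x d y z; [exact: BformPl | exact: BformPr]. Qed.

HB.instance Definition _ :=
  bilinear_isBilinear.Build C calM calM C *%R *%R (Bform eps lam lpow)
    Bform_bilinear.

Lemma bilinear_ext (f g : calM -> calM -> C) :
  (forall d x y z, f (d *: x + y) z = d * f x z + f y z) ->
  (forall d x y z, f z (d *: x + y) = d * f z x + f z y) ->
  (forall d x y z, g (d *: x + y) z = d * g x z + g y z) ->
  (forall d x y z, g z (d *: x + y) = d * g z x + g z y) ->
  (forall v b w c, f (tens v b) (tens w c) = g (tens v b) (tens w c)) ->
  forall x y, f x y = g x y.
Proof.
move=> fl fr gl gr fg x y.
have ext1 (h k : calM -> C) : (forall d x y, h (d *: x + y) = d * h x + h y) ->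
    (forall d x y, k (d *: x + y) = d * k x + k y) ->
    (forall v b, h (tens v b) = k (tens v b)) -> forall z, h z = k z.
  move=> lh lk hk z; rewrite (calM_sum z).
  rewrite (@lin_sum _ calM C^o h lh) (@lin_sum _ calM C^o k lk).
  by apply: eq_bigr => b _; exact: hk.
apply: (ext1 (f ^~ y) (g ^~ y)) => [d x' y'|d x' y'|v b]; [exact: fl|exact: gl|].
apply: (ext1 (f (tens v b)) (g (tens v b))) => [d x' y'|d x' y'|w c].
- exact: fr.
- exact: gr.
- exact: fg.
Qed.

Hypothesis heps : cocycle_structure eps.
Hypothesis lam0 : lam != 0.
Hypothesis lpowD : forall s t, lpow (s + t) = lpow s * lpow t.
Hypothesis lpow_int : forall n : int, lpow n%:~R = lam ^ n.

(** The cocycle identity for (b, - b, b) gives eps(b, - b) = eps(- b, b). *)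
Lemma Bform_sym (x y : calM) : Bform eps lam lpow x y = Bform eps lam lpow y x.
Proof.
move: x y; apply: bilinear_ext => [d x y z|d x y z|d x y z|d x y z|v b w c].
- exact: BformPl.
- exact: BformPr.
- exact: BformPr.
- exact: BformPl.
rewrite !Bform_tens (hformC _ v w) [c + b]addrC; congr (_ * _).
have [bc|_] := eqVneq (b + c) 0; last by rewrite !mulr0.
have -> : c = - b by apply/eqP; rewrite -addr_eq0 addrC bc.
by rewrite (charge_norm_opp lpow heps).
Qed.

Lemma Bform_nondegenerate : nondegenerate_form (Bform eps lam lpow).
Proof.
have nd (y : calM) : (forall x, Bform eps lam lpow x y = 0) -> y = 0.
  move=> y0; apply: calM_ext => b; rewrite [RHS]mcoeff0.
  apply: (hform_nondegenerate (th_neq0 lam0)) => w.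
  have := y0 (tens w (- b)); rewrite Bform_tensl opprK hformC => /eqP.
  by rewrite mulf_eq0 (negbTE (charge_norm_neq0 heps lpowD lpow_int _)) => /eqP.
split=> [x x0|y]; last exact: nd.
by apply: nd => y; rewrite Bform_sym.
Qed.

End BilinearInstance.

Section ComplexPowers.

Lemma exponential_mulrz (V : zmodType) (F : fieldType) (f : V -> F) :
  {morph f : s t / s + t >-> s * t} -> f 0 = 1 ->
  forall v (n : int), f (v *~ n) = f v ^ n.
Proof.
move=> fD f0 v; have fn (n : nat) : f (v *+ n) = f v ^+ n.
  by elim: n => [|n IH]; rewrite ?mulr0n ?f0 // mulrS fD IH exprS.
case=> n; first by rewrite -pmulrn fn.
have fU : f (v *+ n.+1) * f (- (v *+ n.+1)) = 1 by rewrite -fD subrr.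
have fN0 : f (v *+ n.+1) != 0.
  by apply/eqP => E; move/eqP: fU; rewrite E mul0r eq_sym oner_eq0.
rewrite NegzE mulrNz -pmulrn -exprnN -fn; apply: (mulfI fN0).
by rewrite fU divff.
Qed.

Variable R : realType.

Lemma cexpD (z w : R[i]) : cexp (z + w) = cexp z * cexp w.
Proof.
case: z w => [a b] [c d]; apply/eqP; rewrite eq_complex /= expRD cosD sinD.
by apply/andP; split; apply/eqP; ring.
Qed.

Lemma cexp0 : cexp (0 : R[i]) = 1.
Proof. by rewrite /cexp /= expR0 cos0 sin0 mulr0 mulr1. Qed.

Lemma cpowD (ell s t : R[i]) : cpow ell (s + t) = cpow ell s * cpow ell t.
Proof. by rewrite /cpow mulrDl cexpD. Qed.

Lemma cpow0 (ell : R[i]) : cpow ell 0 = 1.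
Proof. by rewrite /cpow mul0r cexp0. Qed.

Lemma cpow1 (ell : R[i]) : cpow ell 1 = cexp ell.
Proof. by rewrite /cpow mul1r. Qed.

Lemma cpow_int (ell : R[i]) (n : int) : cpow ell n%:~R = cexp ell ^ n.
Proof. by rewrite (exponential_mulrz (cpowD ell) (cpow0 ell)) cpow1. Qed.

Lemma cexp_ipi (N : int) :
  odd (absz N) -> cexp (Complex 0 (pi *~ N) : R[i]) = -1.
Proof.
move=> oN; pose f (t : R) : R[i] := cexp (Complex 0 t).
have fD : {morph f : s t / s + t >-> s * t}.
  move=> s t; rewrite /f -cexpD; congr cexp; apply/eqP.
  by rewrite eq_complex /= addr0 !eqxx.
rewrite -[LHS]/(f (pi *~ N)) (exponential_mulrz fD cexp0).
have -> : f pi = -1.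
  apply/eqP; rewrite /f /cexp /= expR0 cospi sinpi mulr0 mul1r eq_complex /=.
  by rewrite oppr0 !eqxx.
case: N oN => n /= on; first by rewrite -exprnP -signr_odd on.
by rewrite NegzE -exprnN -signr_odd /= on expr1 invrN1.
Qed.

Lemma epiND (N : int) (s t : R[i]) : epiN N (s + t) = epiN N s * epiN N t.
Proof. exact: cpowD. Qed.

Lemma epiN_int (N n : int) : odd (absz N) -> epiN N n%:~R = (-1) ^ n :> R[i].
Proof. by move=> oN; rewrite /epiN cpow_int cexp_ipi. Qed.

End ComplexPowers.

Unset Implicit Arguments.
Set Strict Implicit.

Theorem proposition4p7 (R : realType) (l : nat)
    (eps : 'rV[R[i]]_l -> 'rV[R[i]]_l -> R[i]) (N : int) (lam ell : R[i])
    (hl : (1 <= l)%N) (heps : cocycle_structure eps) (hN : odd `|N|%N)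
    (hlam : lam != 0) (hell : cexp ell = lam) :
  exists B : {biscalar calM R[i] l},
    [/\ invariant_form eps lam (cpow ell) (epiN N) B /\ B (vacuum R[i] l) (vacuum R[i] l) = 1,
        forall B' : {biscalar calM R[i] l},
          invariant_form eps lam (cpow ell) (epiN N) B' ->
          B' (vacuum R[i] l) (vacuum R[i] l) = 1 ->
          forall x y, B' x y = B x y,
        forall x y, B x y = B y x,
        nondegenerate_form B
      & forall v b w c,
          B (tens v b) (tens w c)
          = eps b (- b) * cpow ell (- dot b b) * (b + c == 0)%:R
            * B (tens v 0) (tens w 0)].
Proof.
have lpow_int (n : int) : cpow ell n%:~R = lam ^ n by rewrite cpow_int hell.
have lpowD := cpowD ell.
have epowD := @epiND R N.
have epow_int (n : int) : epiN N n%:~R = (-1) ^ n :> R[i] by exact: epiN_int.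
have norm0 : charge_norm eps (cpow ell) (0 : 'rV[R[i]]_l) = 1.
  by rewrite /charge_norm (eps0l heps) dot0r oppr0 cpow0 mulr1.
pose B := Bform eps lam (cpow ell).
have Bnorm : B (vacuum R[i] l) (vacuum R[i] l) = 1.
  by rewrite /B /vacuum Bform_tens norm0 addr0 eqxx hform1 !mulr1.
have Btens v b w c : B (tens v b) (tens w c)
    = eps b (- b) * cpow ell (- dot b b) * (b + c == 0)%:R
      * B (tens v 0) (tens w 0).
  by rewrite /B !Bform_tens norm0 addr0 eqxx !mul1r.
have Buniq (B' : {biscalar calM R[i] l}) :
    invariant_form eps lam (cpow ell) (epiN N) B' ->
    B' (vacuum R[i] l) (vacuum R[i] l) = 1 -> forall x y, B' x y = B x y.
  move=> inv' norm'.
  apply: bilinear_ext => [d x y z|d x y z|d x y z|d x y z|v b w c].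
  - exact: biscalarPl.
  - exact: biscalarPr.
  - exact: BformPl.
  - exact: BformPr.
  rewrite /B Bform_tens.
  apply: (inv_tens heps hlam lpowD lpow_int epowD epow_int _ _ inv' norm').
  - by move=> d x y z; exact: biscalarPl.
  - by move=> d x y z; exact: biscalarPr.
exists (Bform eps lam (cpow ell)); split.
- split; last exact: Bnorm.
  exact: (Bform_invariant heps hlam lpowD lpow_int epowD epow_int).
- exact: Buniq.
- exact: (Bform_sym lam (cpow ell) heps).
- exact: (Bform_nondegenerate heps hlam lpowD lpow_int).
- exact: Btens.
Qed.
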